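(* Let $n\ge 2$. An element $w\in\tilde B_{n+1}$ is CFC if and only if one (equivalently, any) of its reduced expressions $\mathbf{w}$ satisfies one of the following conditions: (a) each generator occurs at most once in $\mathbf{w}$; (b) $\mathbf{w}$ is an alternating word, $|\mathbf{w}_{s_1}|=\cdots=|\mathbf{w}_{s_{n-1}}|=|\mathbf{w}_u|\ge 2$, and $|\mathbf{w}_{t_1}|=|\mathbf{w}_{t_2}|=|\mathbf{w}_{s_1}|/2$ (in particular, $|\mathbf{w}_{s_1}|$ is even); (c) $\mathbf{w}$ is a subword of the infinite periodic word $(t_1t_2s_1s_2\cdots s_{n-1}us_{n-1}\cdots s_2s_1)^{\infty}$, where $t_1$ and $t_2$ are allowed to commute, such that $|\mathbf{w}_{s_1}|=\cdots=|\mathbf{w}_{s_{n-1}}|\ge 2$ and $|\mathbf{w}_{t_1}|=|\mathbf{w}_{t_2}|=|\mathbf{w}_u|=|\mathbf{w}_{s_1}|/2$.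
   Context: $\tilde B_{n+1}$ is the affine Coxeter group with generators $t_1,t_2,s_1,\dots,s_{n-1},u$ whose Coxeter diagram has edges $t_1-s_1$, $t_2-s_1$, $s_i-s_{i+1}$ ($1\le i\le n-2$), all with $m=3$, and $s_{n-1}-u$ with $m=4$ (all other pairs commute). An element of a Coxeter group is fully commutative (FC) if any two of its reduced expressions are related by a sequence of transpositions of adjacent commuting generators. A cyclic shift of a word $s_{i_1}\cdots s_{i_k}$ is any word $s_{i_j}\cdots s_{i_k}s_{i_1}\cdots s_{i_{j-1}}$. An element is cyclically fully commutative (CFC) if every cyclic shift of every one of its reduced expressions is a reduced expression of an FC element. $|\mathbf{w}_s|$ is the number of occurrences of $s$ in $\mathbf{w}$. ''$\mathbf{w}$ is an alternating word'' means: after replacing $t_1$ and $t_2$ by $s_0$, and $u$ by $s_n$, for each $i=0,\dots,n-1$ the occurrences of $s_i$ alternate with those of $s_{i+1}$ (in the sequence obtained by keeping only the letters $s_i,s_{i+1}$, no two consecutive letters are equal), and moreover the occurrences of $t_1$ and $t_2$ alternate in $\mathbf{w}$. ''Subword'' of an infinite word means a finite factor of consecutive letters; ''$t_1$ and $t_2$ are allowed to commute'' means that each factor $t_1t_2$ of the periodic word may independently be replaced by $t_2t_1$. Thus words in (c) take one of the five forms $s_is_{i+1}\cdots s_{i-2}s_{i-1}$, $s_is_{i-1}\cdots s_{i+2}s_{i+1}$, $t_1s_1\cdots s_1t_2$, $t_2s_1\cdots s_1t_1$, $t_1t_2s_1\cdots s_1$ (up to $t_1t_2=t_2t_1$, read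 along the periodic word, with $s_n=u$). *)

(* Defs.v *)
From HB Require Import structures.
From mathcomp Require Import all_boot.
From mathcomp Require Import boolp.

Set Implicit Arguments.
Unset Strict Implicit.
Unset Printing Implicit Defensive.

(* The entry 0 stands for infinity: as a group relator it is trivial. *)
Record coxeter_matrix (I : eqType) := CoxeterMatrix {
  cox_m :> I -> I -> nat;
  cox_m_diag : forall i j, (cox_m i j == 1) = (i == j);
  cox_m_sym : forall i j, cox_m i j = cox_m j i }.

(* The congruence on words generated by (i j)^(m i j) = 1.  As m i i = 1, each
   letter is its own inverse, so the monoid of classes is the Coxeter group. *)
Inductive cox_eq (I : eqType) (m : coxeter_matrix I) : seq I -> seq I -> Prop :=
| cox_eq_rel i j : cox_eq m (flatten (nseq (m i j) [:: i; j])) [::]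
| cox_eq_refl x : cox_eq m x x
| cox_eq_sym x y : cox_eq m x y -> cox_eq m y x
| cox_eq_trans x y z : cox_eq m x y -> cox_eq m y z -> cox_eq m x z
| cox_eq_cat x x' y y' :
    cox_eq m x x' -> cox_eq m y y' -> cox_eq m (x ++ y) (x' ++ y').

Section CoxeterGroup.
Variables (I : choiceType) (m : coxeter_matrix I).

Definition cox_eqb (x y : seq I) : bool := `[< cox_eq m x y >].

Fact cox_eqb_refl : reflexive cox_eqb.
Proof. by move=> x; apply/asboolP; apply: cox_eq_refl. Qed.

Fact cox_eqb_sym : symmetric cox_eqb.
Proof. by move=> x y; apply/asboolP/asboolP; apply: cox_eq_sym. Qed.

Fact cox_eqb_trans : transitive cox_eqb.
Proof.
move=> y x z /asboolP xy /asboolP yz; apply/asboolP.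
exact: cox_eq_trans xy yz.
Qed.

Canonical cox_equiv := EquivRel cox_eqb cox_eqb_refl cox_eqb_sym cox_eqb_trans.

Definition coxeter_group := {eq_quot cox_equiv}%qT.
HB.instance Definition _ := Choice.on coxeter_group.
HB.instance Definition _ := EqQuotient.on coxeter_group.

Definition eval_word (x : seq I) : coxeter_group := (\pi_(coxeter_group) x)%qT.

Lemma eval_wordP (x y : seq I) :
  reflect (cox_eq m x y) (eval_word x == eval_word y).
Proof. by rewrite /eval_word eqmodE; apply: asboolP. Qed.

Lemma repr_cox (g : coxeter_group) : eval_word (repr g) = g.
Proof. exact: reprK. Qed.

Lemma cox_eq_repr (x : seq I) : cox_eq m (repr (eval_word x)) x.
Proof. by apply/eval_wordP; rewrite repr_cox. Qed.

Definition cox_mul (g h : coxeter_group) := eval_word (repr g ++ repr h).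
Definition cox_one := eval_word [::].
Definition cox_inv (g : coxeter_group) := eval_word (rev (repr g)).

Lemma eval_word_cat (x y : seq I) :
  eval_word (x ++ y) = cox_mul (eval_word x) (eval_word y).
Proof.
apply/eqP/eval_wordP/cox_eq_sym/cox_eq_cat; exact: cox_eq_repr.
Qed.

Lemma cox_eq_letter (i : I) : cox_eq m [:: i; i] [::].
Proof.
have := cox_eq_rel m i i.
by have /eqP-> : m i i == 1 by rewrite cox_m_diag.
Qed.

Lemma cox_eq_rev_cat (x : seq I) : cox_eq m (rev x ++ x) [::].
Proof.
elim: x => [|i x IHx]; first exact: cox_eq_refl.
apply: (cox_eq_trans _ IHx); rewrite rev_cons -cats1 -catA /=.
apply: cox_eq_cat (cox_eq_refl _ _) _.
exact: (cox_eq_cat (cox_eq_letter i) (cox_eq_refl m x)).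
Qed.

Fact cox_mulA : associative cox_mul.
Proof.
move=> g h k; rewrite -[g]repr_cox -[h]repr_cox -[k]repr_cox.
by rewrite -!eval_word_cat catA.
Qed.

Fact cox_mul1 : left_id cox_one cox_mul.
Proof. by move=> g; rewrite -[g]repr_cox -eval_word_cat. Qed.

Fact cox_mulg1 : right_id cox_one cox_mul.
Proof. by move=> g; rewrite -[g]repr_cox -eval_word_cat cats0. Qed.

Fact cox_mulV : left_inverse cox_one cox_inv cox_mul.
Proof.
move=> g; rewrite -{2}[g]repr_cox -eval_word_cat.
exact/eqP/eval_wordP/cox_eq_rev_cat.
Qed.

Fact cox_mulgV : right_inverse cox_one cox_inv cox_mul.
Proof.
move=> g; rewrite -{1}[g]repr_cox -eval_word_cat -{1}[repr g]revK.
exact/eqP/eval_wordP/cox_eq_rev_cat.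
Qed.

HB.instance Definition _ := isGroup.Build coxeter_group
  cox_mulA cox_mul1 cox_mulg1 cox_mulV cox_mulgV.

Definition cox_gen (i : I) : coxeter_group := eval_word [:: i].

Lemma eval_wordE (x : seq I) : eval_word x = (\prod_(i <- x) cox_gen i)%g.
Proof.
elim: x => [|i x IHx]; first by rewrite big_nil.
by rewrite big_cons -IHx -cat1s eval_word_cat.
Qed.

Lemma cox_gen_rel (i j : I) : ((cox_gen i * cox_gen j) ^+ m i j = 1)%g.
Proof.
have -> k : ((cox_gen i * cox_gen j) ^+ k)%g =
            eval_word (flatten (nseq k [:: i; j])).
  elim: k => [//|k IHk].
  rewrite expgS IHk -[flatten (nseq k.+1 _)]/([:: i; j] ++ flatten (nseq k _)).
  by rewrite eval_word_cat -[[:: i; j]]/([:: i] ++ [:: j]) (eval_word_cat [:: i]).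
exact/eqP/eval_wordP/cox_eq_rel.
Qed.

Definition reduced (x : seq I) : Prop :=
  forall y : seq I, eval_word y = eval_word x -> size x <= size y.

Definition reduced_expr (w : coxeter_group) (x : seq I) : Prop :=
  eval_word x = w /\ reduced x.

Inductive comm_equiv : seq I -> seq I -> Prop :=
| comm_equiv_refl x : comm_equiv x x
| comm_equiv_step x y i j z :
    m i j = 2 -> comm_equiv z (x ++ [:: i; j] ++ y) ->
    comm_equiv z (x ++ [:: j; i] ++ y).

Definition FC (w : coxeter_group) : Prop :=
  forall x y : seq I, reduced_expr w x -> reduced_expr w y -> comm_equiv x y.

(* The cyclic shifts of x are the words rot k x. *)
Definition CFC (w : coxeter_group) : Prop :=
  forall x : seq I, reduced_expr w x ->
  forall k : nat, reduced (rot k x) /\ FC (eval_word (rot k x)).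

End CoxeterGroup.

(* Generators of the affine Coxeter group of type B~_(n+1), n >= 2;
   Bs i, with i < n - 1, is s_(i+1). *)
Inductive tildeB_gen (n : nat) : Type :=
| Bt1 | Bt2 | Bs of 'I_n.-1 | Bu.
Arguments Bt1 {n}.
Arguments Bt2 {n}.
Arguments Bs {n}.
Arguments Bu {n}.

Section TildeB.
Variable n : nat.
Notation gen := (tildeB_gen n).

Definition tildeB_code (g : gen) : bool + option 'I_n.-1 :=
  match g with
  | Bt1 => inl true
  | Bt2 => inl false
  | Bs i => inr (Some i)
  | Bu => inr None
  end.

Definition tildeB_decode (c : bool + option 'I_n.-1) : gen :=
  match c with
  | inl true => Bt1
  | inl false => Bt2
  | inr (Some i) => Bs i
  | inr None => Bu
  end.

Fact tildeB_codeK : cancel tildeB_code tildeB_decode.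
Proof. by case. Qed.

HB.instance Definition _ := Finite.copy gen (can_type tildeB_codeK).

(* The index of a letter once t_1 and t_2 are replaced by s_0 and u by s_n. *)
Definition level (g : gen) : nat :=
  match g with
  | Bt1 | Bt2 => 0
  | Bs i => i.+1
  | Bu => n
  end.

(* When n >= 2, two generators are joined in the Coxeter diagram exactly when
   their levels differ by 1. *)
Definition tildeB_m (g h : gen) : nat :=
  if g == h then 1
  else if (level g == (level h).+1) || (level h == (level g).+1) then
    if (g == Bu) || (h == Bu) then 4 else 3
  else 2.

Fact tildeB_m_diag g h : (tildeB_m g h == 1) = (g == h).
Proof. by rewrite /tildeB_m; do 3?case: ifP. Qed.

Fact tildeB_m_sym g h : tildeB_m g h = tildeB_m h g.
Proof. by rewrite /tildeB_m eq_sym orbC [(h == Bu) || _]orbC. Qed.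

Definition tildeB_matrix : coxeter_matrix gen :=
  CoxeterMatrix tildeB_m_diag tildeB_m_sym.

Definition tildeB := coxeter_group tildeB_matrix.

Definition alternate (T : eqType) (a b : T) (x : seq T) : bool :=
  sorted (fun c d => c != d) [seq c <- x | (c == a) || (c == b)].

Definition alternating_word (x : seq gen) : Prop :=
  (forall i, i < n -> alternate i i.+1 [seq level g | g <- x]) /\
  alternate Bt1 Bt2 x.

(* One period t1 t2 s_1 ... s_(n-1) u s_(n-1) ... s_1, with t1 and t2
   exchanged when b holds. *)
Definition zigzag_period (b : bool) : seq gen :=
  (if b then [:: Bt2; Bt1] else [:: Bt1; Bt2]) ++
  [seq Bs i | i <- enum 'I_n.-1] ++ Bu :: rev [seq Bs i | i <- enum 'I_n.-1].

(* The infinite word zigzag_period (b 0) ++ zigzag_period (b 1) ++ ..., each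
   period having length 2n+1. *)
Definition zigzag_word (b : nat -> bool) (p : nat) : gen :=
  nth Bu (zigzag_period (b (p %/ n.*2.+1))) (p %% n.*2.+1).

Lemma size_zigzag_period b : 0 < n -> size (zigzag_period b) = n.*2.+1.
Proof.
move=> n_gt0; rewrite !size_cat /= size_rev size_map size_enum_ord.
by case: b; case: n n_gt0 => //= k _; rewrite addnS addnn doubleS.
Qed.

Definition zigzag_subword (x : seq gen) : Prop :=
  exists (b : nat -> bool) (p : nat),
    x = [seq zigzag_word b q | q <- iota p (size x)].

Definition CFC_cond_a (x : seq gen) : Prop :=
  forall g, count_mem g x <= 1.

Definition CFC_cond_b (x : seq gen) : Prop :=
  alternating_word x /\
  exists c, [/\ 2 <= c, forall i, count_mem (Bs i) x = c, count_mem Bu x = c,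
                (count_mem Bt1 x).*2 = c & (count_mem Bt2 x).*2 = c].

Definition CFC_cond_c (x : seq gen) : Prop :=
  zigzag_subword x /\
  exists c, [/\ 2 <= c, forall i, count_mem (Bs i) x = c,
                (count_mem Bt1 x).*2 = c, (count_mem Bt2 x).*2 = c
              & (count_mem Bu x).*2 = c].

End TildeB.

(* Main.v *)
Require Import Defs.
From mathcomp Require Import all_boot all_algebra.
From mathcomp Require Import boolp zify ring.

(** Full commutativity is first made combinatorial.  By Stembridge's criterion, a
    word is a reduced word of a fully commutative element if and only if no word
    reached from it by commutations contains a square i i or one side of a braid
    relation of length at least 3 ([fc_word], [reduced_FC_fc_word],
    [fc_word_reduced_unique]).  The proof rests on the exchange condition, obtained
    from the parity of the reflections that a word sweeps ([refl_parity_eq],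
    [reduced_cons_or_refl]), and on the fact that the product of the generators i
    and j has order exactly m(i,j), which the numbers game shows
    ([tildeB_order]).

    Let x be a word all of whose cyclic shifts satisfy the criterion, and unfold
    it into a periodic sequence.  Number the levels from 0 (t_1 and t_2) to n (u).
    An arc is a stretch between two consecutive occurrences of a letter.  Without
    squares and braids, an arc of s_i contains at least two neighbours of s_i,
    except that an arc of s_(n-1) may contain a single u, provided that the arcs
    next to it contain no u.  Suppose that some letter occurs twice.  Summed over
    a period, these bounds make the counts by level convex, and bound them at both
    ends, so that the counts of the levels 0 to n-1 are all equal
    ([total_constant]).  The sums being tight, so is the bound on each arc: an arc
    of s_i with i at most n-2 contains exactly two neighbours, and two consecutive
    arcs of s_(n-1) contain exactly two s_(n-2) in total.

    This leaves two cases ([top_dichotomy]).  If each arc of s_(n-1) contains one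
    s_(n-2), then tightness propagates this downward: adjacent levels alternate,
    and so do t_1 and t_2.  If the arcs of s_(n-1) contain alternately zero and
    two s_(n-2), then each arc of s_k has all its neighbours above or all below,
    the arcs are nested, and consecutive letters move by one level in a direction
    that is reversed only at the two ends ([zigzag_step_seq]); such a word is read
    along the zigzag word ([zigzag_subword_of_steps]).

    Conversely each of the three conditions, the third one in the local form
    [cyclic_zigzag], is invariant under commutations and cyclic shifts and
    excludes squares and braids; this suffices ([CFC_of_stable]). *)

Set Implicit Arguments.
Unset Strict Implicit.
Unset Printing Implicit Defensive.

(** * The exchange property *)

Section CoxeterWords.
Variables (I : choiceType) (m : coxeter_matrix I).
Local Notation ev := (eval_word m).
Local Notation sg := (cox_gen m).

Lemma evalM x y : ev (x ++ y) = (ev x * ev y)%g.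
Proof. exact: eval_word_cat. Qed.

Lemma eval_cons i x : ev (i :: x) = (sg i * ev x)%g.
Proof. by rewrite -cat1s evalM. Qed.

Lemma cox_gen_sqr i : (sg i * sg i = 1)%g.
Proof. by rewrite -[RHS](cox_gen_rel m i i) (eqP (_ : m i i == 1)) ?cox_m_diag. Qed.

Lemma cox_genK i (w : coxeter_group m) : (sg i * (sg i * w) = w)%g.
Proof. by rewrite mulgA cox_gen_sqr mul1g. Qed.

(** The classical inversion sequence of a word: if x = a i b, the entry at that
    letter i is the conjugate of the generator i by a, and multiplying by it on
    the left deletes the letter. *)
Fixpoint word_refls (x : seq I) : seq (coxeter_group m) :=
  if x is i :: x' then sg i :: [seq (sg i * r * sg i)%g | r <- word_refls x']
  else [::].

Lemma word_refl_delete x r : r \in word_refls x ->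
  exists a i b, x = a ++ i :: b /\ (r * ev x)%g = ev (a ++ b).
Proof.
elim: x r => [//|i x IHx] r; rewrite inE => /orP[/eqP->|/mapP[r' r'x ->]].
  by exists [::], i, x; rewrite eval_cons cox_genK.
have [a [j [b [-> eq_r']]]] := IHx _ r'x.
exists (i :: a), j, b; split=> //.
by rewrite /= !eval_cons -eq_r' -!mulgA cox_genK.
Qed.

Lemma word_refls_cat x y :
  word_refls (x ++ y) =
  word_refls x ++ [seq (ev x * r * (ev x)^-1)%g | r <- word_refls y].
Proof.
elim: x => [|i x IHx] /=.
  by rewrite -[LHS]map_id; apply: eq_map => r; rewrite mul1g invg1 mulg1.
rewrite IHx map_cat -map_comp; congr (_ :: _ ++ _); apply: eq_map => r /=.
rewrite eval_cons invgM -!mulgA; do 4!congr (_ * _)%g.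
by rewrite -[RHS]mulg1 -(cox_gen_sqr i) mulgA mulVg mul1g.
Qed.

Lemma cox_gen_altC i j p :
  (sg i * (sg j * sg i) ^+ p = (sg i * sg j) ^+ p * sg i)%g.
Proof.
elim: p => [|p IHp]; first by rewrite !expg0 mulg1 mul1g.
by rewrite expgSr mulgA IHp expgSr -!mulgA.
Qed.

Fixpoint altw (i j : I) k := if k is k'.+1 then i :: altw j i k' else [::].

Lemma word_refls_altw i j k :
  word_refls (altw i j k) = [seq ((sg i * sg j) ^+ p * sg i)%g | p <- iota 0 k].
Proof.
elim: k i j => [//|k IHk] i j /=; rewrite expg0 mul1g; congr (_ :: _).
rewrite IHk -[1]/(1 + 0) iotaDl -!map_comp; apply: eq_map => p /=.
by rewrite mulgA cox_gen_altC add1n expgSr -!mulgA.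
Qed.

Lemma altw_double i j k : flatten (nseq k [:: i; j]) = altw i j k.*2.
Proof. by elim: k => //= k ->. Qed.

Definition refl_parity (x : seq I) r := odd (count_mem r (word_refls x)).

Lemma refl_parity_cat x y r :
  refl_parity (x ++ y) r =
  refl_parity x r (+) refl_parity y ((ev x)^-1 * r * ev x)%g.
Proof.
rewrite /refl_parity word_refls_cat count_cat oddD count_map.
congr (_ (+) odd _); apply: eq_count => t /=.
apply/eqP/eqP => [<-|->].
  by rewrite -!mulgA mulKg mulVg mulg1.
by rewrite -!mulgA mulVKg mulgV mulg1.
Qed.

(** The multiset of reflections depends on the word, but its reduction modulo 2
    is an invariant of the group element: the relator (i j)^m sweeps twice the
    same sequence of m reflections. *)
Lemma refl_parity_eq x y r : cox_eq m x y -> refl_parity x r = refl_parity y r.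
Proof.
move=> xy; elim: xy r => {x y} [i j r|//|x y _ IH r|x y z _ IH1 _ IH2 r|]; first 1 last.
- by rewrite IH.
- by rewrite IH1.
- move=> x x' y y' xx' IH1 _ IH2 r; rewrite !refl_parity_cat IH1 IH2.
  by have /eqP-> : ev x == ev x' by apply/eval_wordP.
rewrite /refl_parity altw_double word_refls_altw -addnn iotaD map_cat add0n.
have -> : [seq ((sg i * sg j) ^+ p * sg i)%g | p <- iota (m i j) (m i j)] =
          [seq ((sg i * sg j) ^+ p * sg i)%g | p <- iota 0 (m i j)].
  rewrite -[X in iota X _](addn0 (m i j)) iotaDl -map_comp; apply: eq_map => p /=.
  by rewrite expgnDr cox_gen_rel mul1g.
by rewrite count_cat addnn odd_double.
Qed.

Lemma reduced_word_exists (w : coxeter_group m) : exists x, reduced_expr w x.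
Proof.
have ex : exists k, `[< exists x, ev x = w /\ size x = k >].
  by exists (size (repr w)); apply/asboolP; exists (repr w); rewrite repr_cox.
case: (ex_minnP ex) => k /asboolP[x [xw sz_x]] min_k.
exists x; split=> // y yx; rewrite sz_x; apply/min_k/asboolP.
by exists y; rewrite yx xw.
Qed.

(** The exchange condition.  Let y be a reduced word of i x.  If the reflection i
    is not swept by x, then by parity it is swept by y, as i y and x represent
    the same element; deleting a letter of y gives a word of the element of x,
    so y is longer than x. *)
Lemma reduced_cons_or_refl i x :
  reduced m x -> reduced m (i :: x) \/ sg i \in word_refls x.
Proof.
move=> x_red; case: (boolP (sg i \in _)) => [|ix]; [by right | left].
have [y [ey y_red]] := reduced_word_exists (ev (i :: x)).
have eyx : ev (i :: y) = ev x by rewrite eval_cons ey eval_cons cox_genK.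
have par_x : refl_parity x (sg i) = false by rewrite /refl_parity (count_memPn ix).
have /eqP/eval_wordP/(refl_parity_eq (sg i)) := eyx.
rewrite par_x -cat1s refl_parity_cat {1}/refl_parity /= eqxx /=.
rewrite -/(sg i) mulVg mul1g => /negbFE par_y.
have iy : sg i \in word_refls y.
  by rewrite -has_pred1 has_count; apply: odd_gt0.
have [a [j [b [y_ab del]]]] := word_refl_delete iy.
have := x_red (a ++ b); rewrite -del -eval_cons eyx => /(_ erefl) le_x.
move=> z ez; apply: leq_trans (y_red z _); last by rewrite ez.
by move: le_x; rewrite y_ab !size_cat /= addnS.
Qed.

Lemma reduced_factor a b c : reduced m (a ++ b ++ c) -> reduced m b.
Proof.
move=> red_abc y eyb; have := red_abc (a ++ y ++ c).
by rewrite !evalM eyb !size_cat leq_add2l leq_add2r => /(_ erefl).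
Qed.

Lemma reduced_behead i x : reduced m (i :: x) -> reduced m x.
Proof. by have := @reduced_factor [:: i] x [::]; rewrite cats0. Qed.

Lemma eval_rev x : ev (rev x) = (ev x)^-1%g.
Proof.
apply/esym/mulg1_eq; rewrite -evalM -{1}[x]revK.
exact/eqP/eval_wordP/cox_eq_rev_cat.
Qed.

Lemma altw_rcons i j k : rcons (altw i j k) (if odd k then j else i) = altw i j k.+1.
Proof. by elim: k i j => //= k IHk i j; rewrite -IHk; case: (odd k). Qed.

Lemma altw_cat i j k l :
  altw i j (k + l) = altw i j k ++ (if odd k then altw j i l else altw i j l).
Proof. by elim: k i j => //= k IHk i j; rewrite IHk; case: (odd k). Qed.

Lemma rev_altw i j k : rev (altw i j k) = if odd k then altw i j k else altw j i k.
Proof.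
elim: k i j => // k IHk i j; rewrite -{1}altw_rcons rev_rcons IHk /=.
by case: (odd k).
Qed.

Lemma size_altw i j k : size (altw i j k) = k.
Proof. by elim: k i j => //= k IHk i j; rewrite IHk. Qed.

Lemma eval_altw i j : ev (altw i j (m i j)) = ev (altw j i (m i j)).
Proof.
apply: (mulIg (ev (altw j i (m i j)))^-1%g); rewrite mulgV -eval_rev -evalM.
rewrite rev_altw -altw_cat addnn -altw_double.
exact/eqP/eval_wordP/cox_eq_rel.
Qed.

Lemma eval_flatten_nseq i j k :
  ev (flatten (nseq k [:: i; j])) = ((sg i * sg j) ^+ k)%g.
Proof.
elim: k => [//|k IHk].
by rewrite -[flatten _]/([:: i, j & flatten (nseq k _)]) !eval_cons IHk mulgA -expgS.
Qed.

(** * Fully commutative words *)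

Lemma comm_equiv_trans x y z :
  comm_equiv m x y -> comm_equiv m y z -> comm_equiv m x z.
Proof.
move=> xy yz; elim: yz xy => // a b i j z' mij _ IH xz'.
exact: comm_equiv_step mij (IH xz').
Qed.

Lemma comm_equiv_swap a b i j :
  m i j = 2 -> comm_equiv m (a ++ [:: i; j] ++ b) (a ++ [:: j; i] ++ b).
Proof. by move=> mij; apply: comm_equiv_step mij (comm_equiv_refl _ _). Qed.

Lemma comm_equiv_sym x y : comm_equiv m x y -> comm_equiv m y x.
Proof.
elim=> [*|a b i j z mij _ IH]; first exact: comm_equiv_refl.
by apply: comm_equiv_trans IH; apply: comm_equiv_swap; rewrite cox_m_sym.
Qed.

Lemma comm_equiv_factor a b x y :
  comm_equiv m x y -> comm_equiv m (a ++ x ++ b) (a ++ y ++ b).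
Proof.
elim=> [*|c d i j z mij _ IH]; first exact: comm_equiv_refl.
apply: comm_equiv_trans IH _.
by rewrite -!(catA c) -!catA !(catA a c); apply: comm_equiv_swap.
Qed.

Lemma comm_equiv_eval x y : comm_equiv m x y -> ev x = ev y.
Proof.
elim=> // a b i j z mij _ ->; rewrite !evalM; congr (_ * (_ * _))%g.
by have := eval_altw i j; rewrite mij.
Qed.

Lemma comm_equiv_size x y : comm_equiv m x y -> size x = size y.
Proof. by elim=> // a b i j z _ _ ->; rewrite !size_cat. Qed.

(** Letters that do not commute keep their relative order, which is what
    distinguishes the two sides of a braid relation up to commutations. *)
Lemma comm_equiv_filter x y i j : 2 < m i j -> comm_equiv m x y ->
  [seq k <- x | (k == i) || (k == j)] = [seq k <- y | (k == i) || (k == j)].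
Proof.
move=> m_ij; elim=> // a b k l z m_kl _ ->; rewrite !filter_cat /=.
congr (_ ++ (_ ++ _)).
have ne_kl : k != l by rewrite -(cox_m_diag m) m_kl.
case: ifP => // /orP[]/eqP ki; case: ifP => // /orP[]/eqP lj; subst k l.
- by rewrite eqxx in ne_kl.
- by rewrite m_kl in m_ij.
- by rewrite cox_m_sym m_kl in m_ij.
- by rewrite eqxx in ne_kl.
Qed.

(** The words that Stembridge's criterion characterizes; [altw i j (m i j)] is
    one side of the braid relation. *)
Definition fc_word x := forall y, comm_equiv m x y -> forall a b i j,
  y <> a ++ [:: i; i] ++ b /\ (2 < m i j -> y <> a ++ altw i j (m i j) ++ b).

Lemma fc_word_comm x y : comm_equiv m x y -> fc_word x -> fc_word y.
Proof. by move=> xy fx z yz; apply: fx; apply: comm_equiv_trans yz. Qed.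

Lemma fc_word_factor a b c : fc_word (a ++ b ++ c) -> fc_word b.
Proof.
move=> f y /(comm_equiv_factor a c)/f {}f d e i j.
by split=> [y_de|m_ij y_de]; have [f1 f2] := f (a ++ d) (e ++ c) i j;
  [apply: f1 | apply: (f2 m_ij)]; rewrite y_de -!catA.
Qed.

Lemma fc_word_behead i x : fc_word (i :: x) -> fc_word x.
Proof. by have := @fc_word_factor [:: i] x [::]; rewrite cats0. Qed.

Lemma reduced_FC_fc_word x : reduced m x -> FC (ev x) -> fc_word x.
Proof.
move=> x_red x_FC y xy a b i j.
have exy := comm_equiv_eval xy.
have y_red : reduced m y by move=> z; rewrite -exy -(comm_equiv_size xy); apply: x_red.
split=> [y_ab|m_ij y_ab].
  have := y_red (a ++ b); rewrite y_ab !evalM -(cat1s i) evalM.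
  rewrite -/(sg i) cox_gen_sqr mul1g => /(_ erefl).
  by rewrite !size_cat leq_add2l /= ltnNge leqnSn.
have ey : ev (a ++ altw j i (m i j) ++ b) = ev y.
  by rewrite y_ab !evalM eval_altw.
have y'_red : reduced m (a ++ altw j i (m i j) ++ b).
  by move=> z; rewrite ey => /y_red; rewrite y_ab !size_cat !size_altw.
have := x_FC _ _ (conj erefl x_red) (conj (etrans ey (esym exy)) y'_red).
move/(comm_equiv_trans (comm_equiv_sym xy))/(comm_equiv_filter m_ij).
rewrite y_ab !filter_cat => /eqP; rewrite eqseq_cat // eqxx /=.
have fil k : all (fun l => (l == i) || (l == j)) (altw i j k) &&
             all (fun l => (l == i) || (l == j)) (altw j i k).
  by elim: k => //= k /andP[-> ->]; rewrite !eqxx orbT.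
have /andP[/all_filterP-> /all_filterP->] := fil (m i j).
rewrite eqseq_cat ?size_altw // => /andP[/eqP + _].
case: (m i j) m_ij (cox_m_diag m i j) => // k k_gt m1 [ij _].
by move: m1 k_gt; rewrite ij eqxx; case: k {ij}.
Qed.

(** * The combinatorial criterion for full commutativity *)

Section ExactOrders.
Hypothesis m_gt0 : forall i j, 0 < m i j.
Hypothesis cox_order : forall i j r,
  0 < r < m i j -> ((sg i * sg j) ^+ r <> 1)%g.

Lemma altw_refl i j k : k < m i j -> sg j \notin word_refls (altw i j k).
Proof.
move=> k_lt; apply/negP; rewrite word_refls_altw => /mapP[p].
rewrite mem_iota /= add0n => p_lt ej; apply: (@cox_order i j p.+1).
  exact: leq_ltn_trans p_lt k_lt.
by rewrite expgSr mulgA -ej cox_gen_sqr.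
Qed.

(** Induction puts one more letter in front of the alternating prefix.  The
    exchange condition then deletes a letter, and this one lies beyond the
    prefix: an alternating word shorter than m(i,j) does not sweep the
    reflection of the letter put in front of it. *)
Lemma two_descents_altw (w : coxeter_group m) i j xi xj k :
    reduced_expr w (i :: xi) -> reduced_expr w (j :: xj) -> 0 < k <= m i j ->
  exists z, reduced_expr w (altw i j k ++ z).
Proof.
elim: k i j xi xj => [//|[|k] IHk] i j xi xj wi wj k_le; first by exists xi.
rewrite cox_m_sym in k_le.
have [|z [ez z_red]] := IHk _ _ _ _ wj wi; first by rewrite (ltnW (proj2 (andP k_le))).
have k_lt : k.+1 < m j i by [].
have [iz_red|] := reduced_cons_or_refl i z_red.
  have := iz_red xi; rewrite eval_cons ez -(proj1 wi) eval_cons cox_genK.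
  have sz : size (altw j i k.+1 ++ z) = (size xi).+1.
    apply/eqP; rewrite eqn_leq; apply/andP; split.
      by apply: (z_red (i :: xi)); rewrite ez (proj1 wi).
    by apply: (proj2 wi (altw j i k.+1 ++ z)); rewrite ez (proj1 wi).
  by rewrite /= in sz *; rewrite sz => /(_ erefl); rewrite ltnNge leqnSn.
rewrite word_refls_cat mem_cat (negPf (altw_refl k_lt)) => /mapP[r rz ei].
have [a [l [b [z_ab del]]]] := word_refl_delete rz.
have eab : ev (altw i j k.+2 ++ a ++ b) = w.
  rewrite -[LHS]/(ev (i :: altw j i k.+1 ++ a ++ b)) eval_cons evalM -del.
  rewrite -[RHS](cox_genK i) -ez evalM; congr (_ * _)%g.
  by rewrite ei -!mulgA mulKg.
exists (a ++ b); split=> // y; rewrite eab -ez => /z_red/(leq_trans _); apply.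
by rewrite z_ab !size_cat !size_altw [size (l :: b)]/=; lia.
Qed.

(** The hard half of Stembridge's criterion, by induction on the length.  If the
    word were not reduced, the exchange condition would produce a square; if
    another reduced word of the element started with a different letter, the two
    first letters would commute, since otherwise they would produce a braid. *)
Lemma fc_word_reduced_unique x : fc_word x ->
  reduced m x /\ forall y, reduced m y -> ev y = ev x -> comm_equiv m x y.
Proof.
have [k] := ubnP (size x); elim: k x => // k IHk [|i x] /= sz_x fx.
  split=> // y y_red ey; have := y_red [::]; rewrite ey => /(_ erefl).
  by case: y {y_red ey} => // _; apply: comm_equiv_refl.
have {}sz_x : size x < k by [].
have [x_red x_uniq] : reduced m x /\
    forall y, reduced m y -> ev y = ev x -> comm_equiv m x y.
  by apply: IHk => //; apply: fc_word_behead fx.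
have ix_red : reduced m (i :: x).
  have [//|ix] := reduced_cons_or_refl i x_red.
  have [a [j [b [x_ab del]]]] := word_refl_delete ix.
  have eab : ev (i :: a ++ b) = ev x by rewrite eval_cons -del cox_genK.
  have ab_red : reduced m (i :: a ++ b).
    by move=> y; rewrite eab => /x_red; rewrite x_ab /= !size_cat /= addnS.
  have /(comm_equiv_factor [:: i] [::]) := x_uniq _ ab_red eab.
  rewrite !cats0 => xx; case: (fx _ xx [::] (a ++ b) i i) => + _.
  by case.
split=> // -[|j y] y_red ey.
  by have := ix_red [::]; rewrite -ey => /(_ erefl).
have [ij|ne_ij] := eqVneq i j.
  subst j; have /(comm_equiv_factor [:: i] [::]) : comm_equiv m x y.
    apply: x_uniq; first exact: reduced_behead y_red.
    by move: ey; rewrite !eval_cons => /mulgI.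
  by rewrite !cats0.
have [|z [ez z_red]] := @two_descents_altw (ev (i :: x)) i j x y (m i j)
  (conj erefl ix_red) (conj ey y_red).
  by rewrite m_gt0 leqnn.
case E: (m i j) ez z_red (m_gt0 i j) => [//|r] ez z_red _.
have [r' Er] : exists r', r = r'.+1.
  have := cox_m_diag m i j; rewrite (negPf ne_ij) E.
  by case: (r) => // r' _; exists r'.
have i_equiv : comm_equiv m (i :: x) (altw i j r.+1 ++ z).
  have /(comm_equiv_factor [:: i] [::]) : comm_equiv m x (altw j i r ++ z).
    apply: x_uniq; last by move: ez; rewrite /= !eval_cons => /mulgI.
    exact: reduced_behead z_red.
  by rewrite !cats0.
have [m_gt2|] := ltnP 2 (m i j).
  have [_ /(_ m_gt2)] := fx _ i_equiv [::] z i j.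
  by rewrite E.
rewrite E Er !ltnS leqn0 => /eqP r'0; subst r' r.
have m_ij : m i j = 2 by [].
rewrite -[altw _ _ _ ++ z]/([::] ++ [:: i; j] ++ z) in i_equiv ez z_red.
have j_equiv : comm_equiv m (i :: x) ([::] ++ [:: j; i] ++ z).
  exact: comm_equiv_step m_ij i_equiv.
apply: (comm_equiv_trans j_equiv).
have iz_size : size (i :: z) < k.
  by have := comm_equiv_size i_equiv; rewrite /= => -[<-].
have iz_fc : fc_word (i :: z).
  exact: fc_word_behead (fc_word_comm j_equiv fx).
have [_ iz_uniq] := IHk _ iz_size iz_fc.
have /(comm_equiv_factor [:: j] [::]) : comm_equiv m (i :: z) y.
  apply: iz_uniq; first exact: reduced_behead y_red.
  have := comm_equiv_eval j_equiv; rewrite -ey /= !eval_cons.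
  exact: mulgI.
by rewrite !cats0.
Qed.

Lemma fc_word_reduced x : fc_word x -> reduced m x.
Proof. by move=> /fc_word_reduced_unique[]. Qed.

Lemma fc_word_FC x : fc_word x -> FC (ev x).
Proof.
move=> /fc_word_reduced_unique[_ x_uniq] y z [ey y_red] [ez z_red].
exact: comm_equiv_trans (comm_equiv_sym (x_uniq y y_red ey)) (x_uniq z z_red ez).
Qed.

(** Such a property passes from x to all the words reached from it by
    commutations and shifts, so none of these has a square or a long braid; in
    particular x represents a fully commutative element, and its other reduced
    words are among the words reached. *)
Lemma CFC_of_stable (C : seq I -> Prop) x :
    (forall i j b, m i j = 2 -> C ([:: i; j] ++ b) -> C ([:: j; i] ++ b)) ->
    (forall i b, C (i :: b) -> C (rcons b i)) ->
    (forall a b i, ~ C (a ++ [:: i; i] ++ b)) ->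
    (forall a b i j, 2 < m i j -> ~ C (a ++ altw i j (m i j) ++ b)) ->
  C x -> CFC (ev x).
Proof.
move=> C_swap C_rot1 C_sqr C_braid.
have C_rot a b : C (a ++ b) -> C (b ++ a).
  elim: a b => [|i a IHa] b; first by rewrite cats0.
  by move=> /C_rot1; rewrite rcons_cat => /IHa; rewrite cat_rcons.
have C_comm y z : comm_equiv m y z -> C y -> C z.
  elim=> // a b i j z' mij _ IH Cz'.
  by apply: (C_rot _ a); rewrite -catA; apply: C_swap mij _; rewrite catA; apply: C_rot; apply: IH.
have C_fc y : C y -> fc_word y.
  move=> Cy z /C_comm /(_ Cy) Cz a b i j.
  split=> [z_ab|m_ij z_ab]; rewrite z_ab in Cz; first exact: C_sqr Cz.
  exact: C_braid m_ij Cz.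
move=> Cx y [ey y_red] k.
have [_ x_uniq] := fc_word_reduced_unique (C_fc _ Cx).
have Cy : C y by apply: C_comm Cx; apply: x_uniq.
have fc_y : fc_word (rot k y) by apply: C_fc; apply: C_rot; rewrite cat_take_drop.
by split; [apply: fc_word_reduced | apply: fc_word_FC].
Qed.

End ExactOrders.
End CoxeterWords.

(** * Orders of the products of two generators *)

Section NumbersGame.
Import GRing.Theory.
Local Open Scope ring_scope.
Variable n : nat.
Local Notation gen := (tildeB_gen n).
Local Notation mB := (tildeB_matrix n).
Local Notation ev := (eval_word mB).
Local Notation sg := (cox_gen mB).

(** Opposites of the off-diagonal Cartan integers of the reflection
    representation: the product of the entries at (i, j) and (j, i) is
    4 cos(pi / m(i,j))^2, that is 0, 1, 2 for m(i,j) = 2, 3, 4. *)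
Definition game_weight (i k : gen) : int :=
  if mB i k == 3 then 1 else if mB i k == 4 then (if i == Bu then 2 else 1) else 0.

(** Mozes's numbers game: the contragredient of the reflection representation,
    written in coordinates indexed by the generators. *)
Definition play (i : gen) (f : gen -> int) : gen -> int :=
  fun k => if k == i then - f i else f k + game_weight i k * f i.

Definition plays (x : seq gen) f := foldr play f x.

Lemma plays_cat x y f : plays (x ++ y) f = plays x (plays y f).
Proof. exact: foldr_cat. Qed.

Lemma tildeB_m_neq i j : i != j -> mB i j = 2 \/ mB i j = 3 \/ mB i j = 4.
Proof.
rewrite /= /tildeB_m => /negPf->; case: ifP => _; last by left.
by case: ifP => _; right; [right | left].
Qed.

Lemma game_weightP i j : i != j ->
  [\/ [/\ mB i j = 2, game_weight i j = 0 & game_weight j i = 0],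
      [/\ mB i j = 3, game_weight i j = 1 & game_weight j i = 1],
      [/\ mB i j = 4, game_weight i j = 1 & game_weight j i = 2]
    | [/\ mB i j = 4, game_weight i j = 2 & game_weight j i = 1]].
Proof.
move=> ne_ij; rewrite /game_weight (cox_m_sym mB j i).
have [E|[E|E]] := tildeB_m_neq ne_ij; rewrite E /=; [by constructor 1|by constructor 2|].
have ij_u : (i == Bu) || (j == Bu).
  move: E; rewrite /= /tildeB_m (negPf ne_ij); case: ifP => // _.
  by case: ifP.
case/orP: ij_u => /eqP ?; subst.
  by rewrite eqxx eq_sym (negPf ne_ij); constructor 4.
by rewrite eqxx (negPf ne_ij); constructor 3.
Qed.

Lemma play2E i j f (c := game_weight i j) (d := game_weight j i) :
  i != j -> (plays [:: i; j] f i = - (f i + d * f j)) *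
            (plays [:: i; j] f j = - f j + c * (f i + d * f j)).
Proof.
move=> ne_ij; rewrite /plays /= /play !eqxx ![j == i]eq_sym (negPf ne_ij).
by split.
Qed.

Lemma play2E_other i j k f : i != j -> k != i -> k != j ->
  plays [:: i; j] f k =
  f k + game_weight j k * f j + game_weight i k * (f i + game_weight j i * f j).
Proof.
by move=> ne_ij ki kj; rewrite /plays /= /play (negPf ki) (negPf kj) (negPf ne_ij).
Qed.

(** Coordinate by coordinate this is a linear identity, valid for all weights at
    a third letter k: only the weights between i and j matter. *)
Lemma plays_rel i j f : plays (flatten (nseq (mB i j) [:: i; j])) f = f.
Proof.
have [<-|ne_ij] := eqVneq i j.
  have /eqP-> : mB i i == 1%N by rewrite cox_m_diag.
  apply: funext => k; rewrite /plays /= /play eqxx; case: eqP => [->|_]; ring.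
have nseqS k : plays (flatten (nseq k.+1 [:: i; j])) f =
               plays [:: i; j] (plays (flatten (nseq k [:: i; j])) f).
  by rewrite -plays_cat.
apply: funext => k.
have [->|ki] := eqVneq k i; [|have [->|kj] := eqVneq k j];
  have [] := game_weightP ne_ij => -[-> c d]; do ?rewrite nseqS;
  rewrite ?(play2E_other _ ne_ij ki kj) ?(play2E _ ne_ij) c d /=; ring.
Qed.

Lemma plays_eq x y f : cox_eq mB x y -> plays x f = plays y f.
Proof.
move=> xy; elim: xy f => // {x y} [i j|x y z _ IH1 _ IH2|x x' y y' _ IH1 _ IH2] f.
- exact: plays_rel.
- by rewrite IH1.
by rewrite !plays_cat IH2 IH1.
Qed.

Lemma tildeB_order i j r :
  (0 < r < mB i j)%N -> ((sg i * sg j) ^+ r <> 1)%g.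
Proof.
have [<-|ne_ij] := eqVneq i j.
  have /eqP-> : mB i i == 1%N by rewrite cox_m_diag.
  by case: r => [|[]].
rewrite -eval_flatten_nseq => r_lt /eqP/eval_wordP/plays_eq => eq_f.
(* The powers at stake already move the values at i and j of the position that is
   constantly 1. *)
pose f1 := fun _ : gen => 1 : int.
have {eq_f}[] : plays (flatten (nseq r [:: i; j])) f1 i = 1 /\
                plays (flatten (nseq r [:: i; j])) f1 j = 1 by rewrite eq_f.
have nseqS k : plays (flatten (nseq k.+1 [:: i; j])) f1 =
               plays [:: i; j] (plays (flatten (nseq k [:: i; j])) f1).
  by rewrite -plays_cat.
have [] := game_weightP ne_ij => -[E c d]; rewrite E in r_lt;
  case: r r_lt => [|[|[|[|//]]]] // _; do ?rewrite nseqS;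
  rewrite !(play2E _ ne_ij) c d /= /f1; lia.
Qed.

End NumbersGame.

(** * Arcs of a sequence *)

Section Sequence.
Variables (T : Type) (X : nat -> T).
Implicit Types a b : pred T.

Definition window p q := [seq X r | r <- iota p (q - p)].

Definition cnt a p q := count a (window p q).

(** In a periodic sequence, an arc of a predicate that holds once in each period
    is a full period, so that arcs also make sense for letters that a word
    contains only once. *)
Definition arc a p q := [/\ p < q, a (X p), a (X q) & cnt a p.+1 q = 0].

Lemma window_cat q p r : p <= q <= r -> window p r = window p q ++ window q r.
Proof.
case/andP=> pq qr; rewrite -map_cat; congr map.
by rewrite -[X in iota X (r - q)](subnKC pq) -iotaD; congr iota; lia.
Qed.

Lemma window1 p : window p p.+1 = [:: X p].
Proof. by rewrite /window subSnn. Qed.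

Lemma window_cons p q : p < q -> window p q = X p :: window p.+1 q.
Proof. by move=> pq; rewrite (@window_cat p.+1) ?window1 ?leqnSn. Qed.

Lemma window_rcons p q : p <= q -> window p q.+1 = window p q ++ [:: X q].
Proof. by move=> pq; rewrite (@window_cat q) ?window1 ?pq ?leqnSn. Qed.

Lemma size_window p q : size (window p q) = q - p.
Proof. by rewrite size_map size_iota. Qed.

Lemma cnt_cat q a p r : p <= q <= r -> cnt a p r = cnt a p q + cnt a q r.
Proof. by move=> pqr; rewrite /cnt (window_cat pqr) count_cat. Qed.

Lemma cnt1 a p : cnt a p p.+1 = a (X p).
Proof. by rewrite /cnt window1 /= addn0. Qed.

Lemma cntS a p q : p <= q -> cnt a p q.+1 = cnt a p q + a (X q).
Proof. by move=> pq; rewrite (@cnt_cat q) ?pq ?leqnSn // cnt1. Qed.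

Lemma cntSl a p q : p < q -> cnt a p q = a (X p) + cnt a p.+1 q.
Proof. by move=> pq; rewrite (@cnt_cat p.+1) ?pq ?leqnSn // cnt1. Qed.

Lemma cnt_nil a p : cnt a p p = 0.
Proof. by rewrite /cnt /window subnn. Qed.

Lemma cnt_le a p p' q' q : p <= p' -> q' <= q -> cnt a p' q' <= cnt a p q.
Proof.
move=> pp qq; case: (leqP p' q') => pq; last first.
  by rewrite /cnt /window (_ : q' - p' = 0) //; lia.
by rewrite (@cnt_cat p' a p q) 1?(@cnt_cat q' a p' q) //; lia.
Qed.

Lemma cnt_gt0P a p q :
  reflect (exists r, p <= r < q /\ a (X r)) (0 < cnt a p q).
Proof.
rewrite /cnt -has_count has_map; apply: (iffP hasP) => -[r].
  by rewrite mem_iota /= => r_pq ar; exists r; split=> //; lia.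
by case=> r_pq ar; exists r => //; rewrite mem_iota; lia.
Qed.

Lemma cnt_eq0 a p q : cnt a p q = 0 -> forall r, p <= r < q -> ~~ a (X r).
Proof.
move=> c0 r r_pq; apply/negP => ar.
have : 0 < cnt a p q by apply/cnt_gt0P; exists r.
by rewrite c0.
Qed.

Lemma eq_cnt0 a p q : (forall r, p <= r < q -> ~~ a (X r)) -> cnt a p q = 0.
Proof.
move=> na; apply/eqP; rewrite -leqn0 leqNgt; apply/negP => /cnt_gt0P[r [/na]].
by move/negPf->.
Qed.

Lemma arc_cnt a p q : arc a p q -> cnt a p q = 1.
Proof. by case=> pq ap _ c0; rewrite cntSl // ap c0. Qed.

Lemma next_arc a p r : p < r -> a (X p) -> a (X r) ->
  exists q, arc a p q /\ q <= r.
Proof.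
move=> pr ap ar; have ex : exists q, (p < q) && a (X q) by exists r; rewrite pr.
case: (ex_minnP ex) => q /andP[pq aq] min_q; exists q; split.
  split=> //; apply: eq_cnt0 => s /andP[ps sq]; apply/negP => as_.
  by have := min_q s; rewrite ps as_ leqNgt sq => /(_ isT).
by apply: min_q; rewrite pr.
Qed.

Lemma prev_arc a p r : p < r -> a (X p) -> a (X r) ->
  exists q, arc a q r /\ p <= q.
Proof.
move=> pr ap ar; have ex : exists q, (q < r) && a (X q) by exists p; rewrite pr.
have ub q : (q < r) && a (X q) -> q <= r by case/andP => /ltnW.
case: (ex_maxnP ex ub) => q /andP[qr aq] max_q; exists q; split.
  split=> //; apply: eq_cnt0 => s /andP[qs sr]; apply/negP => as_.
  by have := max_q s; rewrite sr as_ leqNgt qs => /(_ isT).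
by apply: max_q; rewrite pr.
Qed.

Lemma arc_path_ind a p (P : nat -> Prop) : a (X p) -> P p ->
    (forall q q', p <= q -> arc a q q' -> P q -> P q') ->
  forall r, p <= r -> a (X r) -> P r.
Proof.
move=> ap Pp Pstep r; have [k] := ubnP r; elim: k r => // k IHk r r_lt.
rewrite leq_eqVlt => /orP[/eqP<- //|pr] ar.
have [q [qr pq]] := prev_arc pr ap ar.
by apply: Pstep (qr) _ => //; case: qr => q_lt aq _ _; apply: IHk => //; lia.
Qed.

Lemma arc_le a p q r : arc a p q -> p < r -> a (X r) -> q <= r.
Proof.
case=> _ _ _ /cnt_eq0 no_a pr ar; rewrite leqNgt; apply/negP => rq.
by have := no_a r; rewrite pr rq ar => /(_ isT).
Qed.

Lemma arc_uniq a p q q' : arc a p q -> arc a p q' -> q = q'.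
Proof.
move=> pq pq'; case: (pq) (pq') => lt aq _ _ [lt' aq' _ _].
by apply/eqP; rewrite eqn_leq (arc_le pq) ?(arc_le pq'); case: (pq); case: (pq').
Qed.

Lemma first_occurrence a p q : 0 < cnt a p q ->
  exists r, [/\ p <= r < q, a (X r) & cnt a p r = 0].
Proof.
move=> /cnt_gt0P[r0 [r0_in ar0]].
have ex : exists r, (p <= r) && a (X r) by exists r0; rewrite ar0 andbT; lia.
case: (ex_minnP ex) => r /andP[pr ar] min_r.
have r_le : r <= r0 by apply: min_r; rewrite ar0 andbT; lia.
exists r; split=> //; first lia.
apply: eq_cnt0 => s s_in; apply/negP => as_.
by have := min_r s; rewrite as_ andbT; lia.
Qed.

Lemma last_occurrence a p q : 0 < cnt a p q ->
  exists r, [/\ p <= r < q, a (X r) & cnt a r.+1 q = 0].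
Proof.
move=> /cnt_gt0P[r0 [r0_in ar0]].
have ex : exists r, (r < q) && a (X r) by exists r0; rewrite ar0 andbT; lia.
have ub r : (r < q) && a (X r) -> r <= q by case/andP => /ltnW.
case: (ex_maxnP ex ub) => r /andP[rq ar] max_r.
have r_ge : r0 <= r by apply: max_r; rewrite ar0 andbT; lia.
exists r; split=> //; first lia.
apply: eq_cnt0 => s s_in; apply/negP => as_.
by have := max_r s; rewrite as_ andbT; lia.
Qed.

Lemma two_occurrences a p q : 2 <= cnt a p q ->
  exists r r', [/\ arc a r r', p <= r, r' < q & cnt a p r = 0].
Proof.
move=> c2; have [|r [r_in ar c0]] := @first_occurrence a p q; first lia.
have /cnt_gt0P[s [s_in as_]] : 0 < cnt a r.+1 q.
  by move: c2; rewrite (@cnt_cat r) ?c0 1?(@cntSl _ r) ?ar; lia.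
have [|r' [rr' r'_le]] := @next_arc a r s _ ar as_; first lia.
by exists r, r'; split=> //; lia.
Qed.

Lemma all_window a p q : (forall r, p <= r < q -> a (X r)) -> all a (window p q).
Proof.
by move=> a_pq; rewrite all_map; apply/allP => r; rewrite mem_iota => r_in; apply: a_pq; lia.
Qed.

Lemma eq_cnt a b p q : a =1 b -> cnt a p q = cnt b p q.
Proof. by move=> ab; apply: eq_count. Qed.

Lemma eq_arc a b p q : a =1 b -> arc a p q -> arc b p q.
Proof. by move=> ab [pq ap aq c0]; split; rewrite -?ab // -(eq_cnt _ _ ab). Qed.

Lemma cnt_disjointU a b p q : (forall x, a x -> ~~ b x) ->
  cnt (fun x => a x || b x) p q = cnt a p q + cnt b p q.
Proof.
move=> disj; rewrite /cnt -count_predUI -[LHS]addn0; congr (_ + _).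
apply/esym/eqP; rewrite -leqn0 -(count_pred0 (window p q)).
by apply: sub_count => x /= /andP[/disj/negPf->].
Qed.

Lemma arc_sum_ge a b k :
    (forall p q, arc a p q -> k <= cnt b p q) ->
  forall p r, p <= r -> a (X p) -> a (X r) -> k * cnt a p r <= cnt b p r.
Proof.
move=> b_arc p r pr ap ar.
apply: (@arc_path_ind a p (fun r => k * cnt a p r <= cnt b p r)) => //.
  by rewrite cnt_nil muln0.
move=> q q' pq qq' IH; have /b_arc := qq'; case: (qq') => lt_qq' _ _ _.
rewrite !(@cnt_cat q _ p q') ?(arc_cnt qq'); lia.
Qed.

End Sequence.

(** * Arcs of a periodic sequence *)

Section PeriodicSequence.
Variables (T : Type) (X : nat -> T) (L : nat).
Hypothesis (L_gt0 : 0 < L) (X_period : forall q, X (q + L) = X q).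
Implicit Types a b : pred T.
Local Notation window := (window X).
Local Notation cnt := (cnt X).
Local Notation arc := (arc X).

Lemma cnt_shift a p q : cnt a (p + L) (q + L) = cnt a p q.
Proof.
rewrite /cnt /window subnDr [p + L]addnC iotaDl -map_comp.
by congr count; apply: eq_map => r /=; rewrite addnC X_period.
Qed.

Lemma cnt_period a p : cnt a p (p + L) = cnt a 0 L.
Proof.
elim: p => [//|p IHp].
have e1 := @cnt_cat _ X p.+1 a p (p + L).+1; have e2 := cntS X a (leq_addr L p).
by rewrite e1 ?cnt1 ?X_period ?IHp in e2; rewrite ?addSn; lia.
Qed.

Lemma arc_shift a p q : arc a p q -> arc a (p + L) (q + L).
Proof. by case=> pq ap aq c0; split; rewrite ?X_period // ?ltn_add2r // -addSn cnt_shift. Qed.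

Lemma next_arc_period a p : a (X p) -> exists q, arc a p q /\ q <= p + L.
Proof. by move=> ap; apply: next_arc; rewrite ?X_period //; lia. Qed.

Lemma prev_arc_period a p : a (X p) -> exists q, arc a q (p + L).
Proof.
move=> ap; have [|//||q [? _]] := @prev_arc _ X a p (p + L); rewrite ?X_period //.
  lia.
by exists q.
Qed.

Lemma arc_lt_period a p q : 2 <= cnt a 0 L -> arc a p q -> q < p + L.
Proof.
move=> c2 [pq ap aq c0]; rewrite ltnNge; apply/negP => q_ge.
move: c2; rewrite -(cnt_period a p) cntSl; last lia.
have := cnt_le X a (leqnn p.+1) q_ge; rewrite c0 ap; lia.
Qed.

Lemma arc_le_period a p q : arc a p q -> q <= p + L.
Proof.
by move=> pq; apply: (arc_le pq); case: (pq); rewrite ?X_period //; lia.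
Qed.

Lemma enclosing_arc a r1 r2 : 0 < cnt a 0 L -> r1 <= r2 -> cnt a r1 r2.+1 = 0 ->
  exists p q, [/\ arc a p q, p < r1 + L & r2 + L < q].
Proof.
move=> a_occurs r12 c0.
have /cnt_gt0P[p0 [p0_in ap0]] : 0 < cnt a r1 (r1 + L) by rewrite cnt_period.
have /cnt_gt0P[q0 [q0_in aq0]] : 0 < cnt a (r2 + L) (r2 + L + L) by rewrite cnt_period.
have p0_lt : p0 < r1 + L by lia.
have ub q : (q < r1 + L) && a (X q) -> q <= r1 + L by case/andP => /ltnW.
have ex : exists q, (q < r1 + L) && a (X q) by exists p0; rewrite p0_lt.
case: (ex_maxnP ex ub) => p /andP[p_lt ap] max_p.
have [|q [pq q_le]] := @next_arc _ X a p q0 _ ap aq0; first lia.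
exists p, q; split=> //; rewrite ltnNge; apply/negP => q_le2.
case: pq => pq _ aq _.
case: (ltnP q (r1 + L)) => [q_lt|q_ge].
  by have := max_p q; rewrite q_lt aq => /(_ isT); lia.
have := cnt_eq0 c0 (r := q - L); rewrite -(X_period (q - L)) subnK ?aq; last lia.
by move=> H; have := H ltac:(lia).
Qed.

Lemma cnt_shiftn k a p q : cnt a (p + k * L) (q + k * L) = cnt a p q.
Proof.
elim: k => [|k IHk]; first by rewrite !addn0.
by rewrite mulSn addnCA addnC (addnCA q) (addnC L) cnt_shift.
Qed.

Lemma arc_shiftn k a p q : arc a p q -> arc a (p + k * L) (q + k * L).
Proof.
move=> pq; elim: k => [|k IHk]; first by rewrite !addn0.
by rewrite mulSn [p + _]addnCA addnC [q + _]addnCA [L + (q + _)]addnC; apply: arc_shift.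
Qed.

(** ** Counting through arcs *)

Lemma arc_total_ge a b k : (forall p q, arc a p q -> k <= cnt b p q) ->
  k * cnt a 0 L <= cnt b 0 L.
Proof.
move=> b_arc; case: (posnP (cnt a 0 L)) => [->|]; first by rewrite muln0.
case/cnt_gt0P=> p [_ ap]; rewrite -(cnt_period a p) -(cnt_period b p).
by apply: arc_sum_ge; rewrite ?leq_addr ?X_period.
Qed.

Lemma arc_total_tight a b k : (forall p q, arc a p q -> k <= cnt b p q) ->
  cnt b 0 L <= k * cnt a 0 L -> forall p q, arc a p q -> cnt b p q = k.
Proof.
move=> b_arc tot p q pq.
move: tot; rewrite -(cnt_period a p) -(cnt_period b p).
case: (pq) => lt_pq ap aq _.
have [q' [pq' q'_le]] := next_arc_period ap.
have q_le := arc_le_period pq.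
rewrite !(@cnt_cat _ X q _ p (p + L)) ?(arc_cnt pq); try lia.
have := arc_sum_ge b_arc q_le aq; rewrite X_period => /(_ ap).
have := b_arc _ _ pq; lia.
Qed.

(** The sum over all pairs of consecutive arcs in a period counts every arc
    twice, so a bound for pairs acts as a bound for the average arc. *)
Lemma arc_pairs_total a b :
    (forall p q r, arc a p q -> arc a q r -> 2 <= cnt b p q + cnt b q r) ->
  cnt a 0 L <= cnt b 0 L /\
  (cnt b 0 L <= cnt a 0 L ->
   forall p q r, arc a p q -> arc a q r -> cnt b p q + cnt b q r = 2).
Proof.
move=> b_pairs.
have sum p p1 : arc a p p1 -> forall q, p <= q -> a (X q) ->
    exists q1, arc a q q1 /\ 2 * cnt a p q <= cnt b p q + cnt b p1 q1.
  move=> pp1 q; case: (pp1) => lt_pp1 ap ap1 _.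
  apply: (@arc_path_ind _ X a p (fun q => exists q1, arc a q q1 /\
                              2 * cnt a p q <= cnt b p q + cnt b p1 q1)) => //.
    by exists p1; rewrite !cnt_nil.
  move=> {}q q' pq qq' [q1 [qq1]].
  rewrite (arc_uniq qq1 qq').
  case: (qq') => lt_qq' _ aq' _.
  have [q2 [q'q2 _]] := next_arc_period aq'.
  have p1_le : p1 <= q' by apply: arc_le pp1 _ aq'; lia.
  case: (q'q2) => lt_q'q2 _ _ _.
  exists q2; split=> //; have := b_pairs _ _ _ qq' q'q2.
  rewrite !(@cnt_cat _ X q _ p q') ?(arc_cnt qq') 1?(@cnt_cat _ X q' _ p1 q2); lia.
split.
  case: (posnP (cnt a 0 L)) => [-> //|/cnt_gt0P[p [_ ap]]].
  have [p1 [pp1 p1_le]] := next_arc_period ap.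
  have [||q1 [pq1]] := sum p p1 pp1 (p + L); rewrite ?X_period ?leq_addr //.
  rewrite (arc_uniq pq1 (arc_shift pp1)) !cnt_period; lia.
move=> tot p q r pq qr; apply/eqP; rewrite eqn_leq b_pairs // andbT.
case: (pq) => lt_pq ap aq _; case: (qr) => lt_qr _ ar _.
have q_le := arc_le_period pq.
have [||q1 [pq1]] := sum q r qr (p + L); rewrite ?X_period //.
rewrite (arc_uniq pq1 (arc_shift pq)).
have r_le := arc_le_period qr.
have := cnt_period a p; have := cnt_period b p; have := cnt_period b q.
rewrite (@cnt_cat _ X q a p (p + L)) 1?(@cnt_cat _ X q b p (p + L)) ?(arc_cnt pq); try lia.
rewrite (@cnt_cat _ X r b q (q + L)); lia.
Qed.

(** ** Exchanging the roles of two predicates *)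

Definition one_per_arc a b := forall p q, arc a p q -> cnt b p q = 1.

(** The cyclic pattern a a b b a a b b and so on. *)
Definition zero_two_arcs a b := forall p q r, arc a p q -> arc a q r ->
  cnt b p q = 0 /\ cnt b q r = 2 \/ cnt b p q = 2 /\ cnt b q r = 0.

Section TwoPredicates.
Variables a b : pred T.
Hypothesis disj_ab : forall x, a x -> ~~ b x.
Hypothesis a_occurs : 0 < cnt a 0 L.

(** Such an arc of a contains both b, hence at least two. *)
Lemma arc_no_other p q : arc b p q -> cnt a p q = 0 ->
  exists p' q', [/\ arc a p' q', p' < p + L & q + L < q'].
Proof.
move=> [lt_pq bp bq _] c0; apply: enclosing_arc => //; first exact: ltnW.
rewrite cntS ?c0; last exact: ltnW.
by case: (boolP (a (X q))) => // /disj_ab; rewrite bq.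
Qed.

(** Both patterns, a b a b and a a b b, are symmetric in a and b. *)
Lemma one_per_arc_sym : one_per_arc a b -> one_per_arc b a.
Proof.
move=> one p q pq; case: (pq) => lt_pq bp bq b0.
have : cnt a p q <> 0.
  move=> c0; have [p' [q' [pq' p'_lt q'_gt]]] := arc_no_other pq c0.
  have := one _ _ pq'; rewrite (@cnt_cat _ X (p + L)); last lia.
  rewrite (@cnt_cat _ X (q + L) b (p + L) q'); last lia.
  by rewrite (@cntSl _ X _ (p + L)) 1?(@cntSl _ X _ (q + L)) ?X_period ?bp ?bq //; lia.
have : ~ 2 <= cnt a p q.
  move=> /two_occurrences[r [r' [rr' pr r'q _]]].
  have := one _ _ rr'; have r_ne : r <> p.
    by move=> rp; case: rr' => _ /disj_ab; rewrite rp bp.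
  have := @cnt_le _ X b p.+1 r r' q; rewrite b0; lia.
lia.
Qed.

Lemma zero_two_arcs_sym : zero_two_arcs a b -> zero_two_arcs b a.
Proof.
move=> zt.
have zt1 p q : arc a p q -> cnt b p q = 0 \/ cnt b p q = 2.
  move=> pq; case: (pq) => _ _ aq _; have [r [qr _]] := next_arc_period aq.
  by have := zt _ _ _ pq qr; lia.
have inside p q r r' : arc b p q -> p <= r -> r' <= q -> a (X r) -> cnt b r r' = 0.
  move=> [_ bp _ b0] pr r'q ar.
  have r_ne : r <> p by move=> rp; move/disj_ab: ar; rewrite rp bp.
  by have := @cnt_le _ X b p.+1 r r' q; rewrite b0; lia.
have le2 p q : arc b p q -> cnt a p q <= 2.
  move=> pq; rewrite leqNgt; apply/negP => c3.
  have [r [r' [rr' pr r'q c0]]] : exists r r', [/\ arc a r r', p <= r, r' < q & cnt a p r = 0].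
    by apply: two_occurrences; lia.
  case: (rr') => lt_rr' ar ar' _.
  have c2 : 2 <= cnt a r' q.
    by move: c3; rewrite (@cnt_cat _ X r) ?c0 1?(@cnt_cat _ X r' a r q) ?(arc_cnt rr') //; lia.
  have [s [s' [ss' r's s'q c0']]] := two_occurrences c2.
  have es : s = r'.
    case: (ltngtP s r') => // lt; first lia.
    by move: c0'; rewrite cntSl // ar'.
  rewrite es in ss'; have := zt _ _ _ rr' ss'.
  rewrite (inside p q r r') ?(inside p q r' s') //; lia.
have ne1 p q : arc b p q -> cnt a p q <> 1.
  move=> pq c1; case: (pq) => lt_pq bp bq _.
  have /cnt_gt0P[r [r_in ar]] : 0 < cnt a p q by rewrite c1.
  have [r0 r0r] := prev_arc_period ar.
  have [r1 [rr1 _]] : exists r1, arc a (r + L) r1 /\ r1 <= r + L + L.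
    by apply: next_arc_period; rewrite X_period.
  have r_ne : r <> p by move=> rp; move/disj_ab: ar; rewrite rp bp.
  have [cl cr] : cnt a p r = 0 /\ cnt a r.+1 q = 0.
    by move: c1; rewrite (@cnt_cat _ X r) 1?(@cntSl _ X a r) ?ar; lia.
  have r0_lt : r0 < p + L.
    rewrite ltnNge; apply/negP => ge; case: r0r => lt ar0 _ _.
    have := cnt_eq0 cl (r := r0 - L); rewrite -(X_period (r0 - L)) subnK ?ar0; last lia.
    by move=> H; have := H ltac:(lia).
  have r1_gt : q + L < r1.
    rewrite ltnNge; apply/negP => le; case: rr1 => lt _ ar1 _.
    have [e|ne] := eqVneq r1 (q + L).
      by move/disj_ab: ar1; rewrite e X_period bq.
    have := cnt_eq0 cr (r := r1 - L); rewrite -(X_period (r1 - L)) subnK ?ar1; last lia.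
    by move=> H; have := H ltac:(lia).
  have := zt _ _ _ r0r rr1.
  have : 0 < cnt b r0 (r + L) by apply/cnt_gt0P; exists (p + L); rewrite X_period; split=> //; lia.
  have : 0 < cnt b (r + L) r1 by apply/cnt_gt0P; exists (q + L); rewrite X_period; split=> //; lia.
  lia.
move=> p q q' pq qq'; case: (pq) => lt_pq bp bq b0; case: (qq') => lt_qq' _ bq' b0'.
have : ~ (cnt a p q = 0 /\ cnt a q q' = 0).
  case=> c0 c0'.
  have [||p1 [q1 [pq1 p1_lt q1_gt]]] := @enclosing_arc a p q' a_occurs.
  - lia.
  - rewrite cntS 1?(@cnt_cat _ X q) ?c0 ?c0'; try lia.
    by case: (boolP (a (X q'))) => // /disj_ab; rewrite bq'.
  have := zt1 _ _ pq1.
  rewrite (@cnt_cat _ X (p + L)) 1?(@cnt_cat _ X (q + L) b (p + L) q1); try lia.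
  rewrite (@cnt_cat _ X (q' + L) b (q + L) q1); try lia.
  rewrite (@cntSl _ X b (p + L)) 1?(@cntSl _ X b (q + L)) 1?(@cntSl _ X b (q' + L));
    try lia.
  by rewrite !X_period bp bq bq'; lia.
have : ~ (cnt a p q = 2 /\ cnt a q q' = 2).
  case=> c2 c2'.
  have [|r1 [r2 [r12 pr1 r2q c01]]] := @two_occurrences _ X a p q; first lia.
  have [|r3 [r4 [r34 qr3 r4q' c03]]] := @two_occurrences _ X a q q'; first lia.
  case: (r12) => lt12 ar1 ar2 _; case: (r34) => lt34 ar3 _ _.
  have cr2 : cnt a r2.+1 q = 0.
    move: c2; rewrite (@cnt_cat _ X r1) ?c01 1?(@cnt_cat _ X r2 a r1 q) ?(arc_cnt r12); try lia.
    by rewrite (@cntSl _ X a r2) ?ar2; lia.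
  have r23 : arc a r2 r3 by split=> //; [lia | rewrite (@cnt_cat _ X q) ?cr2 ?c03 //; lia].
  have := zt _ _ _ r12 r23; rewrite (inside p q r1 r2) //; last lia.
  have : cnt b r2 r3 <= cnt b p.+1 q' by apply: cnt_le; lia.
  by rewrite (@cnt_cat _ X q b p.+1 q') ?b0 1?(@cntSl _ X b q) ?bq ?b0' //; lia.
have := le2 _ _ pq; have := le2 _ _ qq'; have := ne1 _ _ pq; have := ne1 _ _ qq'.
lia.
Qed.

End TwoPredicates.

End PeriodicSequence.

(** * Gaps between equal letters in fully commutative words *)

Section Gaps.
Variables (I : choiceType) (m : coxeter_matrix I).

Lemma comm_equiv_move i b :
  all (fun t => m i t == 2) b -> comm_equiv m (i :: b) (b ++ [:: i]).
Proof.
elim: b => [|t b IHb] /=; first by move=> _; apply: comm_equiv_refl.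
case/andP=> /eqP m_it /IHb ib.
apply: comm_equiv_trans (comm_equiv_swap [::] b m_it) _.
by have := comm_equiv_factor [:: t] [::] ib; rewrite !cats0.
Qed.

Lemma count1_split (T : Type) (a : pred T) b : count a b = 1 ->
  exists b1 t b2, [/\ b = b1 ++ t :: b2, a t, all (predC a) b1 & all (predC a) b2].
Proof.
elim: b => [//|s b IHb] /=; case: (boolP (a s)) => a_s.
  rewrite add1n => -[cb]; exists [::], s, b; split=> //.
  by rewrite all_predC has_count cb.
rewrite add0n => /IHb[b1 [t [b2 [-> a_t b1_a b2_a]]]].
by exists (s :: b1), t, b2; split=> //=; rewrite a_s.
Qed.

(** Between two occurrences of i, moving i through the commuting letters
    produces a square if no letter obstructs, and a braid of length 3 if a
    single letter t with m(i,t) = 3 does. *)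
Lemma fc_gap i b (N := count (fun t => m i t != 2) b) :
  fc_word m (i :: b ++ [:: i]) ->
  2 <= N \/ N = 1 /\ exists2 t, t \in b & (m i t != 2) && (m i t != 3).
Proof.
move=> fcw; case E: N => [|[|k]]; [exfalso | right | by left].
  have b_comm : all (fun t => m i t == 2) b.
    have := has_count (fun t => m i t != 2) b.
    by rewrite -/N E => /negbT; rewrite -all_predC; apply: sub_all => t /=; rewrite negbK.
  have := comm_equiv_factor [::] [:: i] (comm_equiv_move b_comm).
  by rewrite -catA => /fcw /(_ b [::] i i)[].
split=> //; have [b1 [t [b2 [eb m_it b1_comm b2_comm]]]] := count1_split E.
exists t; first by rewrite eb mem_cat inE eqxx orbT.
rewrite m_it /=; apply/negP => /eqP m_it3.
have commE c : all (predC (fun t => m i t != 2)) c -> all (fun t => m i t == 2) c.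
  by apply: sub_all => s /=; rewrite negbK.
have e1 := comm_equiv_factor [::] (t :: b2 ++ [:: i]) (comm_equiv_move (commE _ b1_comm)).
have e2 := comm_equiv_factor (b1 ++ [:: i; t]) [::]
  (comm_equiv_sym (comm_equiv_move (commE _ b2_comm))).
have e : comm_equiv m (i :: b ++ [:: i]) (b1 ++ altw i t 3 ++ b2).
  apply: comm_equiv_trans (_ : comm_equiv m _ (b1 ++ [:: i; t] ++ b2 ++ [:: i])) _.
    by move: e1; rewrite eb /= -!catA.
  by move: e2; rewrite !cats0 -!catA.
have [_] := fcw _ e b1 b2 i t.
by rewrite m_it3 => /(_ isT).
Qed.

(** A braid of length 4 needs two overlapping gaps, from i to i and from j to j,
    each with a single obstruction. *)
Lemma fc_gap4 i j b1 b2 b3 : m i j = 4 ->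
    all (fun t => m i t == 2) (b1 ++ b2) -> all (fun t => m j t == 2) (b2 ++ b3) ->
  ~ fc_word m (i :: b1 ++ j :: b2 ++ i :: b3 ++ [:: j]).
Proof.
rewrite !all_cat => m_ij /andP[i1 i2] jb fcw.
have e1 := comm_equiv_factor [::] (j :: b2 ++ i :: b3 ++ [:: j]) (comm_equiv_move i1).
have e2 := comm_equiv_factor (b1 ++ [:: i; j]) (b3 ++ [:: j])
  (comm_equiv_sym (comm_equiv_move i2)).
have j23 : all (fun t => m j t == 2) (b2 ++ b3) by rewrite all_cat.
have e3 := comm_equiv_factor (b1 ++ [:: i; j; i]) [::]
  (comm_equiv_sym (comm_equiv_move j23)).
have e : comm_equiv m (i :: b1 ++ j :: b2 ++ i :: b3 ++ [:: j])
                      (b1 ++ altw i j 4 ++ b2 ++ b3).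
  apply: comm_equiv_trans (_ : comm_equiv m _ (b1 ++ i :: j :: b2 ++ i :: b3 ++ [:: j])) _.
    by move: e1; rewrite /= -!catA.
  apply: comm_equiv_trans (_ : comm_equiv m _ (b1 ++ [:: i; j; i] ++ b2 ++ b3 ++ [:: j])) _.
    by move: e2; rewrite /= -!catA.
  by move: e3; rewrite !cats0 /= -!catA.
have [_] := fcw _ e b1 (b2 ++ b3) i j.
by rewrite m_ij => /(_ isT).
Qed.

End Gaps.

(** * Levels in type affine B *)

(** A strict descent at an interior level would propagate down to level 0,
    against the bound there.  So the counts do not decrease, and the bound at the
    top makes them constant. *)
Lemma convex_counts_constant n (c : nat -> nat) i : 2 <= n ->
    (forall j, 1 <= j <= n.-2 -> 2 <= c j -> 2 * c j <= c j.-1 + c j.+1) ->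
    (2 <= c n.-1 -> c n.-1 <= c n.-2) -> (2 <= c 1 -> c 0 <= c 1) ->
    1 <= i <= n.-1 -> 2 <= c i ->
  2 <= c n.-1 /\ forall j, j <= n.-1 -> c j = c n.-1.
Proof.
move=> n_ge2 c_convex c_top c_bot i_in ci.
have no_descent j : 1 <= j <= n.-2 -> 2 <= c j -> c j <= c j.+1.
  elim: j => [//|j IHj] j_in cj; rewrite leqNgt; apply/negP => lt.
  have := c_convex _ j_in cj; rewrite [j.+1.-1]/= => conv.
  case: (posnP j) => [j0|j_gt0]; first by have := c_bot; rewrite j0 in conv lt cj; lia.
  by have := IHj; lia.
have up k : i + k <= n.-1 -> 2 <= c (i + k).
  elim: k => [|k IHk] le; first by rewrite addn0.
  by have := no_descent (i + k); rewrite addnS in le *; lia.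
have c_ge2 : 2 <= c n.-1 by have := up (n.-1 - i); rewrite subnKC; lia.
have c_eq : c n.-2 = c n.-1.
  have := c_top c_ge2; case: (leqP n 2) => [n_le2|n_gt2].
    have n2 : n = 2 by lia.
    by move: c_bot c_ge2; rewrite n2 /=; lia.
  have := no_descent n.-2; have -> : n.-2.+1 = n.-1 by lia.
  lia.
have down k j : j + k = n.-2 -> c j = c n.-1 /\ c j.+1 = c n.-1.
  elim: k j => [|k IHk] j jk.
    by rewrite addn0 in jk; rewrite jk; split=> //; congr c; lia.
  have [cj1 cj2] := IHk j.+1 ltac:(lia); split=> //.
  have := @c_convex j.+1; rewrite [j.+1.-1]/= cj1 cj2 => conv.
  case: (posnP j) => [j0|j_gt0]; last by have := no_descent j; lia.
  by have := c_bot; rewrite j0 in conv cj1 *; lia.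
split=> // j j_le; case: (leqP j n.-2) => [j_le2|j_gt].
  by have [] := down (n.-2 - j) j; first lia.
by congr c; lia.
Qed.

Section Levels.
Variable n : nat.
Hypothesis n_ge2 : 1 < n.
Local Notation gen := (tildeB_gen n).
Local Notation mB := (tildeB_matrix n).
Implicit Types g h : gen.

Definition at_level i : pred gen := fun g => level g == i.

Lemma level_le g : level g <= n.
Proof. by case: g => //= i; have := ltn_ord i; lia. Qed.

Lemma level_inj g h : 0 < level g -> level g = level h -> g = h.
Proof.
case: g => [||i|] //= _; case: h => [||j|] //= e; try lia.
- by congr Bs; apply/ord_inj; case: e.
- by have := ltn_ord i; lia.
- by have := ltn_ord j; lia.
Qed.

Lemma level_eqn g : (level g == n) = (g == Bu).
Proof.
by apply/eqP/eqP => [e|-> //]; apply: level_inj; rewrite e //; lia.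
Qed.

Lemma level0P g : level g = 0 -> g = Bt1 \/ g = Bt2.
Proof. by case: g => [||i|] /=; [left | right | | lia]. Qed.

Lemma count_level0 (x : seq gen) :
  count (at_level 0) x = count_mem Bt1 x + count_mem Bt2 x.
Proof.
elim: x => //= g x ->; rewrite addnACA; congr (_ + _).
by case: g => [||i|]; rewrite /at_level /= ?eqxx //; case: eqP => //; lia.
Qed.

Lemma level_exists i : i <= n -> exists g, level g = i.
Proof.
move=> i_le; case: i i_le => [|i] i_le; first by exists Bt1.
case: (ltnP i n.-1) => i_lt; first by exists (Bs (Ordinal i_lt)).
by exists Bu => /=; lia.
Qed.

Definition adjacent_levels g h :=
  (level g == (level h).+1) || (level h == (level g).+1).

Lemma tildeB_m_neq2 g h : g != h -> (mB g h != 2) = adjacent_levels g h.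
Proof.
move=> /negPf ne_gh; rewrite /= /tildeB_m ne_gh /adjacent_levels.
by case: ifP => // _; case: ifP.
Qed.

Lemma tildeB_m4 g h : mB g h != 2 -> mB g h != 3 -> g != h ->
  mB g h = 4 /\ (level g = n.-1 /\ level h = n \/ level g = n /\ level h = n.-1).
Proof.
move=> m2 m3 ne_gh; have adj : adjacent_levels g h by rewrite -tildeB_m_neq2.
have E : mB g h = if (level g == n) || (level h == n) then 4 else 3.
  by rewrite /= /tildeB_m (negPf ne_gh) -/(adjacent_levels g h) adj !level_eqn.
move: m3; rewrite E; case: ifP => // lev _; split=> //.
by have := level_le g; have := level_le h; move: adj lev; rewrite /adjacent_levels; lia.
Qed.

Lemma tildeB_m_top g h : level g = n.-1 -> level h = n -> mB g h = 4.
Proof.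
move=> gl hl; have /eqP hu : h == Bu by rewrite -level_eqn hl.
subst h; rewrite /= /tildeB_m eqxx orbT; case: eqP => [gu|_].
  by move: gl; rewrite gu /=; lia.
by rewrite gl /= prednK ?eqxx ?orbT //; lia.
Qed.

(** Three consecutive letters of the infinite zigzag word: the direction is kept
    at interior levels, reversed at u, and reversed at level 0 after a visit to
    both t_1 and t_2. *)
Definition zigzag_step (a b c : gen) : bool :=
  if level b == 0 then
    [&& level a == 0, a != b & level c == 1] || [&& level a == 1, level c == 0 & b != c]
  else if level b == n then (level a == n.-1) && (level c == n.-1)
  else (level a == (level b).-1) && (level c == (level b).+1) ||
       (level a == (level b).+1) && (level c == (level b).-1).

End Levels.

(** * Periodic sequences all of whose periods are fully commutative *)

Section CyclicWords.
Variable n : nat.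
Hypothesis n_ge2 : 1 < n.
Local Notation gen := (tildeB_gen n).
Local Notation mB := (tildeB_matrix n).
Variables (X : nat -> gen) (L : nat).
Hypotheses (L_gt0 : 0 < L) (X_period : forall q, X (q + L) = X q).
Hypothesis X_fc : forall p, fc_word mB (window X p (p + L)).
Local Notation cnt := (cnt X).
Local Notation arc := (arc X).
Local Notation lv := (@at_level n).
Local Notation total a := (cnt a 0 L).

Lemma fc_subwindow p q r : p <= q <= r -> r <= p + L -> fc_word mB (window X q r).
Proof.
move=> pqr r_le; apply: (@fc_word_factor _ _ (window X p q) _ (window X r (p + L))).
by rewrite -!window_cat; try lia; apply: X_fc.
Qed.

(** An arc with a single neighbour of its letter is possible only at the edge of
    weight 4, between the levels n-1 and n. *)
Lemma arc_adjacent g p q (N := cnt (adjacent_levels g) p q) :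
    arc (pred1 g) p q -> q < p + L ->
  2 <= N \/ [/\ N = 1, level g = n.-1 & 0 < cnt (lv n) p q] \/
            [/\ N = 1, level g = n & 0 < cnt (lv n.-1) p q].
Proof.
move=> [lt_pq /eqP Xp /eqP Xq c0] q_lt.
have ew : window X p q.+1 = g :: window X p.+1 q ++ [:: g].
  by rewrite window_cons 1?window_rcons ?Xp ?Xq; try lia.
have := @fc_subwindow p p q.+1; rewrite ew => /(_ ltac:(lia) ltac:(lia))/fc_gap.
have not_g t : t \in window X p.+1 q -> g != t.
  by move=> t_in; apply/eqP => gt; have := count_memPn; move: c0; rewrite /cnt => /eqP;
     rewrite -leqn0 leqNgt -has_count has_pred1 gt t_in.
have -> : count (fun t => mB g t != 2) (window X p.+1 q) = N.
  have irr : adjacent_levels g g = false by rewrite /adjacent_levels; lia.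
  rewrite /N cntSl // Xp irr add0n; apply: eq_in_count => t /not_g ne_gt.
  exact: tildeB_m_neq2.
case=> [|[N1 [t t_in /andP[m2 m3]]]]; [by left | right].
have in_cnt i : level t = i -> 0 < cnt (lv i) p q.
  move=> ti; rewrite cntSl //; suff : 0 < cnt (lv i) p.+1 q by lia.
  by rewrite -has_count; apply/hasP; exists t => //; apply/eqP.
have [_ [[gl tl]|[gl tl]]] := tildeB_m4 n_ge2 m2 m3 (not_g _ t_in); [left | right];
  by split=> //; apply: in_cnt.
Qed.

Lemma arc_pred1 i p q : 0 < i -> arc (lv i) p q -> arc (pred1 (X p)) p q.
Proof.
move=> i_gt0 pq; apply: eq_arc (pq) => g /=; case: pq => _ /eqP Xp _ _.
by apply/eqP/eqP => [gi|-> //]; apply: level_inj; rewrite ?gi.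
Qed.

Lemma cnt_adjacent g p q : 0 < level g ->
  cnt (adjacent_levels g) p q = cnt (lv (level g).-1) p q + cnt (lv (level g).+1) p q.
Proof.
move=> g_gt0; rewrite -cnt_disjointU.
  by apply: eq_cnt => t; rewrite /adjacent_levels /at_level; apply/idP/idP; lia.
by move=> t; rewrite /at_level; lia.
Qed.

Lemma cnt_above_top p q : cnt (lv n.+1) p q = 0.
Proof.
by apply: eq_cnt0 => r _; rewrite /at_level; have := level_le n_ge2 (X r); lia.
Qed.

Lemma lv_disjoint i j : i != j -> forall g, lv i g -> ~~ lv j g.
Proof. by move=> ij g; rewrite /at_level => /eqP->. Qed.

(** ** What full commutativity says about a single arc *)

Lemma arc_t t p q : level t = 0 -> 2 <= total (pred1 t) -> arc (pred1 t) p q ->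
  2 <= cnt (lv 1) p q.
Proof.
move=> t0 c2 pq; have q_lt := arc_lt_period L_gt0 X_period c2 pq.
have -> : cnt (lv 1) p q = cnt (adjacent_levels t) p q.
  by apply: eq_cnt => g; rewrite /adjacent_levels /at_level t0.
by case: (arc_adjacent pq q_lt) => [//|[[_ e _]|[_ e _]]]; lia.
Qed.

Lemma arc_inner i p q : 1 <= i <= n.-2 -> 2 <= total (lv i) -> arc (lv i) p q ->
  2 <= cnt (lv i.-1) p q + cnt (lv i.+1) p q.
Proof.
move=> i_in c2 pq; have q_lt := arc_lt_period L_gt0 X_period c2 pq.
case: (pq) => _ /eqP Xp _ _.
have lv_gt0 : 0 < i by lia.
have := arc_adjacent (arc_pred1 lv_gt0 pq) q_lt; rewrite cnt_adjacent Xp; try lia.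
by case=> [?|[[? e ?]|[? e ?]]]; lia.
Qed.

Lemma arc_u p q : 2 <= total (lv n) -> arc (lv n) p q -> 1 <= cnt (lv n.-1) p q.
Proof.
move=> c2 pq; have q_lt := arc_lt_period L_gt0 X_period c2 pq.
case: (pq) => _ /eqP Xp _ _.
have lv_gt0 : 0 < n by lia.
have := arc_adjacent (arc_pred1 lv_gt0 pq) q_lt; rewrite cnt_adjacent Xp ?cnt_above_top; try lia.
by case=> [?|[[? e ?]|[? e ?]]]; lia.
Qed.

Section TopArcs.
Hypothesis c_ge2 : 2 <= total (lv n.-1).

Lemma arc_top_u p q : arc (lv n.-1) p q -> cnt (lv n) p q <= 1.
Proof.
move=> pq; rewrite leqNgt; apply/negP => u2.
have q_lt := arc_lt_period L_gt0 X_period c_ge2 pq.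
have cu : 2 <= total (lv n).
  by rewrite -(cnt_period L_gt0 X_period _ p); apply: leq_trans u2 _; apply: cnt_le; lia.
have [r [r' [rr' pr r'q _]]] := two_occurrences u2.
have := arc_u cu rr'; case: (pq) => _ Xp _ c0.
have r_ne : r <> p.
  by move=> rp; case: rr' => _; rewrite rp; move: Xp; rewrite /at_level => /eqP->; lia.
by have := @cnt_le _ X (lv n.-1) p.+1 r r' q; rewrite c0; lia.
Qed.

Lemma arc_top p q : arc (lv n.-1) p q ->
  [\/ 2 <= cnt (lv n.-2) p q,
      cnt (lv n.-2) p q = 1 /\ cnt (lv n) p q = 1 |
      cnt (lv n.-2) p q = 0 /\ cnt (lv n) p q = 1].
Proof.
move=> pq; have q_lt := arc_lt_period L_gt0 X_period c_ge2 pq.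
have u1 := arc_top_u pq; case: (pq) => _ /eqP Xp _ _.
have lv_gt0 : 0 < n.-1 by lia.
have := arc_adjacent (arc_pred1 lv_gt0 pq) q_lt; rewrite cnt_adjacent Xp; try lia.
have -> : n.-1.+1 = n by lia.
rewrite -[n.-1.-1]/(n.-2) => H.
case E: (cnt (lv n.-2) p q) => [|[|k]]; [constructor 3|constructor 2|constructor 1] => //.
  by case: H => [?|[[? e ?]|[? e ?]]]; lia.
by case: H => [?|[[? e ?]|[? e ?]]]; lia.
Qed.

Lemma not_between a p q r : cnt a p.+1 q = 0 -> p < r < q -> ~~ a (X r).
Proof. by move=> c0 r_in; apply: cnt_eq0 c0 _ _; lia. Qed.

Lemma commutes_top r g : level g = n.-1 ->
  ~~ lv n.-2 (X r) -> ~~ lv n.-1 (X r) -> ~~ lv n (X r) -> mB g (X r) == 2.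
Proof.
rewrite /at_level => gl r1 r2 r3; have ne : g != X r.
  by apply/eqP => e; rewrite -e gl eqxx in r2.
apply: contraTT isT; rewrite tildeB_m_neq2 // /adjacent_levels gl.
by move: r1 r2 r3; lia.
Qed.

Lemma commutes_u r g : level g = n ->
  ~~ lv n.-1 (X r) -> ~~ lv n (X r) -> mB g (X r) == 2.
Proof.
rewrite /at_level => gl r2 r3; have ne : g != X r.
  by apply/eqP => e; rewrite -e gl eqxx in r3.
apply: contraTT isT; rewrite tildeB_m_neq2 // /adjacent_levels gl.
by have := level_le n_ge2 (X r); move: r2 r3; lia.
Qed.

(** An arc of s_(n-1) that contains only u, followed by an arc containing u,
    would be a braid s u s u. *)
Lemma arc_top_next p q r : arc (lv n.-1) p q -> arc (lv n.-1) q r ->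
  cnt (lv n.-2) p q = 0 -> cnt (lv n) q r = 0.
Proof.
move=> pq qr r0; apply/eqP; rewrite -leqn0 leqNgt; apply/negP.
case/first_occurrence=> v [v_in Xv v_first].
have u1 : cnt (lv n) p q = 1 by have := arc_top pq; rewrite r0; case=> [?|[? ?]|[? ?]]; lia.
have /first_occurrence[w [w_in Xw w_first]] : 0 < cnt (lv n) p q by rewrite u1.
have w_last : cnt (lv n) w.+1 q = 0.
  by move: u1; rewrite (@cnt_cat _ _ w) 1?(@cntSl _ _ _ w) ?Xw ?w_first; lia.
have r_le : r <= p + L.
  apply: arc_le qr _ _; first exact: (arc_lt_period L_gt0 X_period c_ge2 pq).
  by rewrite X_period; case: pq.
case: (pq) => lt_pq Xp Xq pq0; case: (qr) => lt_qr _ Xr qr0.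
have w_ne : w <> p.
  by move=> e; move: Xp; rewrite -e /at_level (eqP Xw); lia.
have v_ne : v <> q.
  by move=> e; move: Xq; rewrite -e /at_level (eqP Xv); lia.
have ew : window X p v.+1 = X p :: window X p.+1 w ++ X w :: window X w.+1 q ++
                            X q :: window X q.+1 v ++ [:: X v].
  rewrite (@window_cons _ X p); last lia.
  rewrite (@window_cat _ X w p.+1 v.+1) ?(@window_cons _ X w v.+1); try lia.
  rewrite (@window_cat _ X q w.+1 v.+1) ?(@window_cons _ X q v.+1); try lia.
  by rewrite window_rcons //; lia.
have := @fc_subwindow p p v.+1 ltac:(lia) ltac:(lia).
have eXq : X q = X p by apply: level_inj; rewrite ?(eqP Xp) ?(eqP Xq) //; lia.
have eXv : X v = X w by apply: level_inj; rewrite ?(eqP Xv) ?(eqP Xw) //; lia.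
rewrite ew eXq eXv; apply: fc_gap4.
- by apply: tildeB_m_top; [| exact/eqP | exact/eqP].
- rewrite all_cat; apply/andP; split; apply: all_window => s s_in;
    apply: commutes_top; rewrite ?(eqP Xp) //.
  + by apply: (cnt_eq0 r0); lia.
  + by apply: (not_between pq0); lia.
  + by apply: (cnt_eq0 w_first); lia.
  + by apply: (cnt_eq0 r0); lia.
  + by apply: (not_between pq0); lia.
  + by apply: (cnt_eq0 w_last); lia.
- rewrite all_cat; apply/andP; split; apply: all_window => s s_in;
    apply: commutes_u; rewrite ?(eqP Xw) //.
  + by apply: (not_between pq0); lia.
  + by apply: (cnt_eq0 w_last); lia.
  + by apply: (not_between qr0); lia.
  + by apply: (cnt_eq0 v_first); lia.
Qed.

(** The mirror image: u s u s. *)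
Lemma arc_top_prev p q r : arc (lv n.-1) p q -> arc (lv n.-1) q r ->
  cnt (lv n.-2) q r = 0 -> cnt (lv n) p q = 0.
Proof.
move=> pq qr r0; apply/eqP; rewrite -leqn0 leqNgt; apply/negP.
case/last_occurrence=> v [v_in Xv v_last].
have u1 : cnt (lv n) q r = 1 by have := arc_top qr; rewrite r0; case=> [?|[? ?]|[? ?]]; lia.
have /first_occurrence[w [w_in Xw w_first]] : 0 < cnt (lv n) q r by rewrite u1.
have w_last : cnt (lv n) w.+1 r = 0.
  by move: u1; rewrite (@cnt_cat _ _ w) 1?(@cntSl _ _ _ w) ?Xw ?w_first; lia.
have r_le : r <= p + L.
  apply: arc_le qr _ _; first exact: (arc_lt_period L_gt0 X_period c_ge2 pq).
  by rewrite X_period; case: pq.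
case: (pq) => lt_pq Xp Xq pq0; case: (qr) => lt_qr _ Xr qr0.
have v_ne : v <> p.
  by move=> e; move: Xp; rewrite -e /at_level (eqP Xv); lia.
have w_ne : w <> q.
  by move=> e; move: Xq; rewrite -e /at_level (eqP Xw); lia.
have ew : window X v r.+1 = X v :: window X v.+1 q ++ X q :: window X q.+1 w ++
                            X w :: window X w.+1 r ++ [:: X r].
  rewrite (@window_cons _ X v); last lia.
  rewrite (@window_cat _ X q v.+1 r.+1) ?(@window_cons _ X q r.+1); try lia.
  rewrite (@window_cat _ X w q.+1 r.+1) ?(@window_cons _ X w r.+1); try lia.
  by rewrite window_rcons //; lia.
have := @fc_subwindow v v r.+1 ltac:(lia) ltac:(lia).
have eXr : X r = X q by apply: level_inj; rewrite ?(eqP Xr) ?(eqP Xq) //; lia.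
have eXw : X w = X v by apply: level_inj; rewrite ?(eqP Xv) ?(eqP Xw) //; lia.
rewrite ew eXr eXw; apply: fc_gap4.
- by rewrite cox_m_sym; apply: tildeB_m_top; [| exact/eqP | exact/eqP].
- rewrite all_cat; apply/andP; split; apply: all_window => s s_in;
    apply: commutes_u; rewrite ?(eqP Xv) //.
  + by apply: (not_between pq0); lia.
  + by apply: (cnt_eq0 v_last); lia.
  + by apply: (not_between qr0); lia.
  + by apply: (cnt_eq0 w_first); lia.
- rewrite all_cat; apply/andP; split; apply: all_window => s s_in;
    apply: commutes_top; rewrite ?(eqP Xq) //.
  + by apply: (cnt_eq0 r0); lia.
  + by apply: (not_between qr0); lia.
  + by apply: (cnt_eq0 w_first); lia.
  + by apply: (cnt_eq0 r0); lia.
  + by apply: (not_between qr0); lia.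
  + by apply: (cnt_eq0 w_last); lia.
Qed.

Lemma arc_top_pairs p q r : arc (lv n.-1) p q -> arc (lv n.-1) q r ->
  2 <= cnt (lv n.-2) p q + cnt (lv n.-2) q r.
Proof.
move=> pq qr; have next := arc_top_next pq qr; have prev := arc_top_prev pq qr.
by case: (arc_top pq) => [?|[? ?]|[? ?]]; case: (arc_top qr) => [?|[? ?]|[? ?]]; lia.
Qed.

End TopArcs.

(** ** The letter counts *)

Lemma total_letter g : 0 < level g -> total (pred1 g) = total (lv (level g)).
Proof.
move=> g_gt0; apply: eq_cnt => h /=; rewrite /at_level.
by apply/eqP/eqP => [-> //|e]; apply: level_inj; rewrite ?e.
Qed.

Lemma cnt_level0 p q : cnt (lv 0) p q = cnt (pred1 Bt1) p q + cnt (pred1 Bt2) p q.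
Proof. exact: count_level0. Qed.

Lemma total_t t : level t = 0 -> 2 <= total (lv 1) ->
  2 * total (pred1 t) <= total (lv 1).
Proof.
move=> t0 c1; case: (leqP 2 (total (pred1 t))) => [ct|]; last lia.
by apply: (arc_total_ge L_gt0 X_period) => p q; apply: arc_t.
Qed.

(** Summed over a period, the bounds on arcs say that the counts by level are
    convex at the interior levels, and bound them at the two ends. *)
Lemma total_constant g : 2 <= total (pred1 g) -> 2 <= total (lv n.-1) /\
  forall j, j <= n.-1 -> total (lv j) = total (lv n.-1).
Proof.
move=> cg; have [i [i_in ci]] : exists i, 1 <= i <= n.-1 /\ 2 <= total (lv i).
  case: (posnP (level g)) => [g0|g_gt0].
    exists 1; split; first lia.
    have : 2 * total (pred1 g) <= total (lv 1); last lia.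
    by apply: (arc_total_ge L_gt0 X_period) => p q; apply: arc_t.
  rewrite total_letter // in cg; have := level_le n_ge2 g.
  case: (eqVneq (level g) n) => [gn|g_ne] g_le; last by exists (level g); split; lia.
  exists n.-1; split; first lia; rewrite gn in cg.
  have : 1 * total (lv n) <= total (lv n.-1); last lia.
  by apply: (arc_total_ge L_gt0 X_period) => p q; apply: arc_u.
apply: (convex_counts_constant (c := fun j => total (lv j)) n_ge2 _ _ _ i_in ci).
- move=> j j_in cj; rewrite -cnt_disjointU; last by apply: lv_disjoint; lia.
  apply: (arc_total_ge L_gt0 X_period) => p q pq.
  by rewrite cnt_disjointU; [apply: arc_inner | apply: lv_disjoint; lia].
- move=> c2; have [|//] := arc_pairs_total L_gt0 X_period (a := lv n.-1) (b := lv n.-2).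
  by move=> p q r; apply: arc_top_pairs.
- move=> c1; rewrite cnt_level0.
  by have := @total_t Bt1 erefl c1; have := @total_t Bt2 erefl c1; lia.
Qed.

Section ConstantCounts.
Variable c : nat.
Hypotheses (c_ge2 : 2 <= c) (total_level : forall j, j <= n.-1 -> total (lv j) = c).

Lemma total_tE t : level t = 0 -> 2 * total (pred1 t) = c.
Proof.
have c0 := total_level (leq0n n.-1); rewrite cnt_level0 in c0.
have c1 : total (lv 1) = c by apply: total_level; lia.
have := @total_t Bt1 erefl; have := @total_t Bt2 erefl.
by rewrite c1 => /(_ c_ge2) le2 /(_ c_ge2) le1 /(level0P n_ge2)[]->; lia.
Qed.

(** Equality in the counting inequalities forces equality in each arc. *)
Lemma arc_inner_eq i p q : 1 <= i <= n.-2 -> arc (lv i) p q ->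
  cnt (lv i.-1) p q + cnt (lv i.+1) p q = 2.
Proof.
move=> i_in pq; have disj : forall g, lv i.-1 g -> ~~ lv i.+1 g by apply: lv_disjoint; lia.
rewrite -cnt_disjointU //; apply: (arc_total_tight L_gt0 X_period (a := lv i) (k := 2)) => //.
  by move=> p' q' pq'; rewrite cnt_disjointU //; apply: arc_inner; rewrite ?total_level //; lia.
by rewrite cnt_disjointU // !total_level; lia.
Qed.

Lemma arc_top_eq p q r : arc (lv n.-1) p q -> arc (lv n.-1) q r ->
  cnt (lv n.-2) p q + cnt (lv n.-2) q r = 2.
Proof.
have [|_ tight] := arc_pairs_total L_gt0 X_period (a := lv n.-1) (b := lv n.-2).
  by move=> p' q' r' ; apply: arc_top_pairs; rewrite total_level.
by apply: tight; rewrite !total_level; lia.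
Qed.

Lemma arc_t_eq t p q : level t = 0 -> arc (pred1 t) p q -> cnt (lv 1) p q = 2.
Proof.
move=> t0; apply: (arc_total_tight L_gt0 X_period); last first.
  by rewrite (total_tE t0) total_level; lia.
move=> {}p {}q pq; case: (leqP 2 (total (pred1 t))) => [ct|ct]; first exact: (arc_t t0 ct pq).
have q_le := arc_le_period L_gt0 X_period pq; case: (pq) => lt_pq Xp Xq c0.
have q_eq : q = p + L.
  apply/eqP; rewrite eqn_leq q_le leqNgt; apply/negP => q_lt.
  have := cnt_period L_gt0 X_period (pred1 t) p.
  by rewrite (@cnt_cat _ X q) ?(arc_cnt pq) 1?(@cntSl _ X _ q) ?Xq; lia.
by rewrite q_eq cnt_period // total_level //; lia.
Qed.

Lemma level_occurs j : j <= n.-1 -> 0 < total (lv j).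
Proof. by move=> j_le; rewrite total_level //; lia. Qed.

(** Two consecutive arcs of s_(n-1) share two letters s_(n-2), so having exactly
    one of them propagates from an arc to the next. *)
Lemma top_arcs_alike p q p' q' : arc (lv n.-1) p q -> arc (lv n.-1) p' q' ->
  cnt (lv n.-2) p q = 1 -> cnt (lv n.-2) p' q' = 1.
Proof.
move=> pq pq' one; rewrite -(cnt_shiftn X_period p).
have := arc_shiftn X_period p pq'; move: (p' + p * L) (q' + p * L) (leq_addl p' (p * L)).
move=> r s r_ge rs; have {r_ge} pr : p <= r by apply: leq_trans r_ge; rewrite leq_pmulr.
case: (pq) => _ Xp _ _; case: (rs) => _ Xr _ _.
suff H : forall s, arc (lv n.-1) r s -> cnt (lv n.-2) r s = 1 by apply: H.
apply: (@arc_path_ind _ X (lv n.-1) p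
  (fun r => forall s, arc (lv n.-1) r s -> cnt (lv n.-2) r s = 1)) => //.
  by move=> q1 pq1; rewrite (arc_uniq pq1 pq).
move=> q1 q2 _ q12 IH q3 q23.
by have := arc_top_eq q12 q23; rewrite (IH _ q12); lia.
Qed.

Lemma top_dichotomy :
  one_per_arc X (lv n.-1) (lv n.-2) \/ zero_two_arcs X (lv n.-1) (lv n.-2).
Proof.
have /cnt_gt0P[p [_ Xp]] := level_occurs (leqnn n.-1).
have [q [pq _]] := next_arc_period L_gt0 X_period Xp.
case: (eqVneq (cnt (lv n.-2) p q) 1) => [e|ne]; [left | right].
  by move=> p' q' pq'; apply: top_arcs_alike pq pq' e.
move=> p1 p2 p3 p12 p23; have eq2 := arc_top_eq p12 p23.
have ne12 : cnt (lv n.-2) p1 p2 <> 1.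
  by move=> e; have := top_arcs_alike p12 pq e; move/eqP: ne.
lia.
Qed.

(** ** One s_(n-2) in each arc of s_(n-1) *)

Section Alternating.
Hypothesis one_top : one_per_arc X (lv n.-1) (lv n.-2).

(** Downward induction: an arc of s_i contains one s_(i+1) by symmetry, hence one
    letter of level i-1, as it contains two neighbours of s_i. *)
Lemma one_per_level_low i : i <= n.-2 ->
  one_per_arc X (lv i.+1) (lv i) /\ one_per_arc X (lv i) (lv i.+1).
Proof.
move=> i_le; have [k] : exists k, i + k = n.-2 by exists (n.-2 - i); rewrite subnKC.
have symm j : j < n -> one_per_arc X (lv j.+1) (lv j) -> j.+1 <= n.-1 ->
    one_per_arc X (lv j) (lv j.+1).
  move=> _ one j_le; apply: (one_per_arc_sym L_gt0 X_period _ (level_occurs j_le) one).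
  by apply: lv_disjoint; lia.
elim: k i {i_le} => [|k IHk] i ik.
  rewrite addn0 in ik; have one : one_per_arc X (lv i.+1) (lv i).
    by rewrite ik; have -> : n.-2.+1 = n.-1 by lia.
  by split=> //; apply: symm => //; lia.
have [_ one_up] := IHk i.+1 ltac:(lia).
have one : one_per_arc X (lv i.+1) (lv i).
  move=> p q pq; have := arc_inner_eq (i := i.+1) ltac:(lia) pq.
  by rewrite (one_up _ _ pq) /=; lia.
by split=> //; apply: symm => //; lia.
Qed.

Lemma one_per_level i : i < n ->
  one_per_arc X (lv i.+1) (lv i) /\ one_per_arc X (lv i) (lv i.+1).
Proof.
move=> i_lt; case: (leqP i n.-2) => [|i_gt]; first exact: one_per_level_low.
have top : one_per_arc X (lv n.-1) (lv n).
  have c2 : 2 <= total (lv n.-1) by rewrite total_level.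
  by move=> p q pq; have := one_top pq; case: (arc_top c2 pq) => [?|[? ?]|[? ?]]; lia.
have -> : i = n.-1 by lia.
have -> : n.-1.+1 = n by lia.
split=> //; apply: (one_per_arc_sym L_gt0 X_period _ (level_occurs (leqnn _)) top).
by apply: lv_disjoint; lia.
Qed.

Lemma total_top : total (lv n) = c.
Proof.
have [] := @one_per_level n.-1 ltac:(lia); have -> : n.-1.+1 = n by lia.
move=> one_n one_n1.
have := arc_total_ge L_gt0 X_period (k := 1) (fun p q pq => eq_leq (esym (one_n p q pq))).
have := arc_total_ge L_gt0 X_period (k := 1) (fun p q pq => eq_leq (esym (one_n1 p q pq))).
by rewrite total_level //; lia.
Qed.

(** An arc of t_1 contains two s_1, between which there is one letter of level
    0, which must be t_2. *)
Lemma t_between t t' p q : level t = 0 -> (forall g, level g = 0 -> g = t \/ g = t') ->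
  arc (pred1 t) p q -> 0 < cnt (pred1 t') p q.
Proof.
move=> t0 tt' pq; have := arc_t_eq t0 pq => c2.
have [|r [r' [rr' pr r'q _]]] := @two_occurrences _ X (lv 1) p q; first by rewrite c2.
have [one _] := @one_per_level 0 ltac:(lia).
have /cnt_gt0P[v [v_in Xv]] : 0 < cnt (lv 0) r r' by rewrite one.
apply/cnt_gt0P; exists v; split; first lia.
case: (tt' (X v) (eqP Xv)) => [e|->]; last by rewrite /= eqxx.
have v_ne : v <> p.
  move=> vp; have rv : r = v by lia.
  by case: rr' => _; rewrite rv /at_level (eqP Xv).
by case: pq => _ _ _ /cnt_eq0/(_ v ltac:(lia)); rewrite /= e eqxx.
Qed.

End Alternating.

(** ** Alternately zero and two s_(n-2) in the arcs of s_(n-1) *)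

Section Zigzag.
Hypothesis zero_two_top : zero_two_arcs X (lv n.-1) (lv n.-2).

Lemma top_arc_u p q : arc (lv n.-1) p q ->
  2 * cnt (lv n) p q + cnt (lv n.-2) p q = 2.
Proof.
move=> pq; have c2 : 2 <= total (lv n.-1) by rewrite total_level.
case: (pq) => _ Xp _ _; have [o op] := prev_arc_period L_gt0 X_period Xp.
have pq' := arc_shift X_period pq.
rewrite -(cnt_shift X_period _ p) -(cnt_shift X_period (lv n.-2) p).
have := zero_two_top op pq'; have := arc_top_next c2 op pq'.
by case: (arc_top c2 pq') => [?|[? ?]|[? ?]]; lia.
Qed.

Lemma total_u : 2 * total (lv n) = c.
Proof.
have /cnt_gt0P[p [_ Xp]] := level_occurs (leqnn n.-1).
have : 2 * cnt (lv n) p (p + L) + cnt (lv n.-2) p (p + L) = 2 * cnt (lv n.-1) p (p + L).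
  apply: (@arc_path_ind _ X (lv n.-1) p
    (fun q => 2 * cnt (lv n) p q + cnt (lv n.-2) p q = 2 * cnt (lv n.-1) p q)).
  - by [].
  - by rewrite !cnt_nil.
  - move=> q r pq qr IH; have := top_arc_u qr; have := arc_cnt qr; case: (qr) => lt_qr _ _ _.
    by rewrite !(@cnt_cat _ X q _ p r); lia.
  - exact: leq_addr.
  - by rewrite X_period.
by rewrite !(cnt_period L_gt0 X_period) (total_level (leqnn _)) (@total_level n.-2); lia.
Qed.

(** The same induction as in the alternating case: the arcs of s_i that contain
    two s_(i+1) contain no letter of level i-1, and conversely. *)
Lemma zero_two_level i : i <= n.-2 ->
  zero_two_arcs X (lv i.+1) (lv i) /\ zero_two_arcs X (lv i) (lv i.+1).
Proof.
move=> i_le; have [k] : exists k, i + k = n.-2 by exists (n.-2 - i); rewrite subnKC.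
have symm j : j < n -> zero_two_arcs X (lv j.+1) (lv j) -> j.+1 <= n.-1 ->
    zero_two_arcs X (lv j) (lv j.+1).
  move=> _ zt j_le; apply: (zero_two_arcs_sym L_gt0 X_period _ (level_occurs j_le) zt).
  by apply: lv_disjoint; lia.
elim: k i {i_le} => [|k IHk] i ik.
  rewrite addn0 in ik; have zt : zero_two_arcs X (lv i.+1) (lv i).
    by rewrite ik; have -> : n.-2.+1 = n.-1 by lia.
  by split=> //; apply: symm => //; lia.
have [_ zt_up] := IHk i.+1 ltac:(lia).
have zt : zero_two_arcs X (lv i.+1) (lv i).
  move=> p q r pq qr; have := arc_inner_eq (i := i.+1) ltac:(lia) pq.
  have := arc_inner_eq (i := i.+1) ltac:(lia) qr.
  by have := zt_up _ _ _ pq qr; rewrite /=; lia.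
by split=> //; apply: symm => //; lia.
Qed.

(** An arc of s_k has its neighbours on one side.  At the top level, a single u
    replaces the two letters above level k. *)
Lemma arc_sides k p q : 1 <= k <= n.-1 -> arc (lv k) p q ->
  cnt (lv k.-1) p q = 2 /\ cnt (lv k.+1) p q = 0 \/
  cnt (lv k.-1) p q = 0 /\ 0 < cnt (lv k.+1) p q.
Proof.
move=> k_in pq; case: (pq) => _ _ Xq _; have [r [qr _]] := next_arc_period L_gt0 X_period Xq.
have [zt _] := @zero_two_level k.-1 ltac:(lia).
have := zt p q r; rewrite prednK; last lia.
move=> /(_ pq qr); case: (eqVneq k n.-1) => [kn|k_ne].
  have := top_arc_u; rewrite kn; have -> : n.-1.+1 = n by lia.
  rewrite kn in pq qr; move=> u; have := u _ _ pq; rewrite -[n.-1.-1]/(n.-2); lia.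
by have := arc_inner_eq (i := k) ltac:(lia) pq; lia.
Qed.

Lemma arc_sides_next k p q r : 1 <= k <= n.-1 -> arc (lv k) p q -> arc (lv k) q r ->
  cnt (lv k.-1) p q + cnt (lv k.-1) q r = 2.
Proof.
move=> k_in pq qr; have [zt _] := @zero_two_level k.-1 ltac:(lia).
by have := zt p q r; rewrite prednK; [move=> /(_ pq qr); lia | lia].
Qed.

(** Arcs are nested: an arc of s_k that goes up contains no s_(k-1), so it lies in
    an arc of s_(k-1), which goes up too, and induction on k applies. *)
Lemma arc_up_no_lower k p q : 1 <= k <= n.-1 -> arc (lv k) p q ->
  0 < cnt (lv k.+1) p q -> cnt (fun g => level g < k) p q = 0.
Proof.
elim: k p q => [//|k IHk] p q k_in pq up.
have low0 : cnt (lv k) p q = 0.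
  by have := arc_sides k_in pq; rewrite /=; lia.
case: (posnP k) => [k0|k_gt0].
  by rewrite -low0; apply: eq_cnt => g; rewrite /at_level k0; lia.
case: (pq) => lt_pq Xp Xq _.
have occ : 0 < total (lv k) by apply: level_occurs; lia.
have [||p' [q' [pq' p'_lt q'_gt]]] :=
  @enclosing_arc _ X L L_gt0 X_period (lv k) p q occ; first lia.
  rewrite cntS ?low0; last lia.
  by move: Xq; rewrite /at_level; lia.
have up' : 0 < cnt (lv k.+1) p' q'.
  by apply/cnt_gt0P; exists (p + L); rewrite X_period; split=> //; lia.
have := IHk p' q' ltac:(lia) pq' up' => none.
have : cnt (fun g => level g < k) p q = 0.
  have := @cnt_le _ X (fun g => level g < k) p' (p + L) (q + L) q'.
  by rewrite none (cnt_shift X_period); lia.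
move=> none'; rewrite -[RHS](addn0 0) -{1}none' -low0 -cnt_disjointU.
  by apply: eq_cnt => g; rewrite /at_level; lia.
by move=> g; rewrite /at_level; lia.
Qed.

(** The mirror image, by induction from the top level. *)
Lemma arc_down_no_upper k p q : 1 <= k <= n.-1 -> arc (lv k) p q ->
  0 < cnt (lv k.-1) p q -> cnt (fun g => k < level g) p q = 0.
Proof.
move=> k_in; have [d] : exists d, k + d = n.-1 by exists (n.-1 - k); lia.
elim: d k p q k_in => [|d IHd] k p q k_in kd pq down.
  have : cnt (lv k.+1) p q = 0 by have := arc_sides k_in pq; lia.
  move=> <-; apply: eq_cnt => g; rewrite /at_level.
  by have := level_le n_ge2 g; lia.
have up0 : cnt (lv k.+1) p q = 0 by have := arc_sides k_in pq; lia.
case: (pq) => lt_pq Xp Xq _.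
have occ : 0 < total (lv k.+1) by apply: level_occurs; lia.
have [||p' [q' [pq' p'_lt q'_gt]]] :=
  @enclosing_arc _ X L L_gt0 X_period (lv k.+1) p q occ; first lia.
  rewrite cntS ?up0; last lia.
  by move: Xq; rewrite /at_level; lia.
have down' : 0 < cnt (lv k.+1.-1) p' q'.
  by apply/cnt_gt0P; exists (p + L); rewrite X_period; split=> //; lia.
have := IHd k.+1 p' q' ltac:(lia) ltac:(lia) pq' down' => none.
have : cnt (fun g => k.+1 < level g) p q = 0.
  have := @cnt_le _ X (fun g => k.+1 < level g) p' (p + L) (q + L) q'.
  by rewrite none (cnt_shift X_period); lia.
move=> none'; rewrite -[RHS](addn0 0) -{1}none' -up0 -cnt_disjointU.
  by apply: eq_cnt => g; rewrite /at_level; lia.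
by move=> g; rewrite /at_level; lia.
Qed.

Lemma arc_one_side k p q r s : 1 <= k <= n.-1 -> arc (lv k) p q ->
  p <= r < q -> p <= s < q -> ~ (level (X r) < k /\ k < level (X s)).
Proof.
move=> k_in pq r_in s_in [Xr Xs].
have some_low : 0 < cnt (fun g => level g < k) p q by apply/cnt_gt0P; exists r.
have some_up : 0 < cnt (fun g => k < level g) p q by apply/cnt_gt0P; exists s.
have := arc_up_no_lower k_in pq; have := arc_down_no_upper k_in pq.
by have := arc_sides k_in pq; lia.
Qed.

(** Consecutive letters that skip a level k would lie in the same arc of s_k, on
    both sides of level k. *)
Lemma consecutive_levels q (i := level (X q)) (j := level (X q.+1)) :
  j = i.+1 \/ i = j.+1 \/ i = 0 /\ j = 0 /\ X q <> X q.+1.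
Proof.
have skip k : 1 <= k <= n.-1 -> i <> k -> j <> k -> exists p' q',
    [/\ arc (lv k) p' q', p' < q + L & q.+1 + L < q'].
  move=> k_in ik jk; apply: (enclosing_arc L_gt0 X_period) => //.
    by apply: level_occurs; lia.
  apply: eq_cnt0 => r r_in; rewrite /at_level; apply/eqP.
  by have [->|->] : r = q \/ r = q.+1 by lia.
have [Xq Xq1] : X (q + L) = X q /\ X (q.+1 + L) = X q.+1 by rewrite !X_period.
have i_le : i <= n by apply: level_le. have j_le : j <= n by apply: level_le.
have far : i < j -> j <> i.+1 -> False.
  move=> ij j_ne; have [||p' [q' [pq' p'_lt q'_gt]]] := skip i.+1 _ _ j_ne; try lia.
  have := arc_one_side (k := i.+1) (r := q + L) (s := q.+1 + L) ltac:(lia) pq'.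
  by rewrite Xq Xq1 -/i -/j; lia.
have far' : j < i -> i <> j.+1 -> False.
  move=> ij i_ne; have [||p' [q' [pq' p'_lt q'_gt]]] := skip j.+1 _ i_ne; try lia.
  have := arc_one_side (k := j.+1) (r := q.+1 + L) (s := q + L) ltac:(lia) pq'.
  by rewrite Xq Xq1 -/i -/j; lia.
case: (ltngtP i j) => [ij|ij|ij]; [by lia | by lia |].
case: (posnP i) => [i0|i_gt0].
  right; right; split=> //; split; first by rewrite -ij.
  move=> eX; have qq1 : arc (pred1 (X q)) q q.+1.
    by split; rewrite ?leqnn // /= ?eqxx // -?eX ?eqxx // cnt_nil.
  by have := arc_t_eq i0 qq1; rewrite cnt1 /at_level; lia.
have [i_n|i_ne] := eqVneq i n; last first.
  have qq1 : arc (lv i) q q.+1.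
    split; [exact: leqnn | | | exact: cnt_nil]; rewrite /at_level.
      by rewrite -/i.
    by rewrite -/j -ij.
  have := arc_sides (k := i) ltac:(lia) qq1; rewrite !cnt1 /at_level -/i.
  have ne_up : (i == i.+1) = false by lia.
  have ne_low : (i == i.-1) = false by lia.
  by rewrite ne_up ne_low; lia.
have [||p' [q' [pq' p'_lt q'_gt]]] := skip n.-1 ltac:(lia); try lia.
have := top_arc_u pq'; rewrite (@cnt_cat _ X (q + L) _ p' q'); last lia.
rewrite (@cntSl _ X _ (q + L)) ?(@cntSl _ X _ (q + L).+1); try lia.
by rewrite -addSn Xq Xq1 /at_level -/i -/j -ij i_n eqxx; lia.
Qed.

(** At an interior level the direction cannot be reversed, because the arcs
    before and after a letter go to opposite sides; at level 0 the letters come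
    in pairs, because an arc of s_1 contains zero or two of them. *)
Lemma zigzag_step_seq q : zigzag_step (X q) (X q.+1) (X q.+2).
Proof.
have := consecutive_levels q; have := consecutive_levels q.+1.
set a := X q; set b := X q.+1; set d := X q.+2 => adj_bd adj_ab.
have b_le := level_le n_ge2 b; have a_le := level_le n_ge2 a; have d_le := level_le n_ge2 d.
rewrite /zigzag_step; case: (eqVneq (level b) 0) => [b0|b_gt0].
  have : ~ (level a = 1 /\ level d = 1).
    case=> a1 d1; have qq2 : arc (lv 1) q q.+2.
      by split; rewrite /at_level -/a -/d ?a1 ?d1 // cnt1 -/b b0.
    have := arc_sides (k := 1) ltac:(lia) qq2.
    by rewrite !(@cntSl _ X _ q) ?(cnt1 X _ q.+1) /at_level -/a -/b ?a1 ?b0 /=; lia.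
  have : ~ (level a = 0 /\ level d = 0).
    case=> a0 d0; have c0 : cnt (lv 1) q q.+3 = 0.
      apply: eq_cnt0 => r r_in; rewrite /at_level.
      have [->|[->|->]] : r = q \/ r = q.+1 \/ r = q.+2 by lia.
      - by rewrite -/a a0.
      - by rewrite -/b b0.
      - by rewrite -/d d0.
    have occ : 0 < total (lv 1) by apply: level_occurs; lia.
    have [|//|p' [q' [pq' p'_lt q'_gt]]] := @enclosing_arc _ X L L_gt0 X_period (lv 1) q q.+2 occ.
      lia.
    have : 3 <= cnt (lv 0) p' q'.
      have e3 : cnt (lv 0) q q.+3 = 3.
        by rewrite !cntS ?cnt_nil /at_level -/a -/b -/d ?a0 ?b0 ?d0 //; lia.
      rewrite -{1}e3 -(cnt_shift X_period); apply: cnt_le; lia.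
    by have := arc_sides (k := 1) ltac:(lia) pq'; rewrite /=; lia.
  by move: adj_ab adj_bd; rewrite b0 => -[?|[?|[? [_ /eqP ?]]]] [?|[?|[_ [? /eqP ?]]]] H1 H2; lia.
case: (eqVneq (level b) n) => [bn|b_n].
  by lia.
have k_in : 1 <= level b <= n.-1 by lia.
have Xb : lv (level b) (X (q.+1 + L)) by rewrite X_period /at_level.
have lvb : lv (level b) (X q.+1) by rewrite /at_level.
have [p' prev] := prev_arc_period L_gt0 X_period lvb.
have [r' [next _]] := next_arc_period L_gt0 X_period Xb.
have sum := arc_sides_next k_in prev next.
have sides_p := arc_sides k_in prev; have sides_n := arc_sides k_in next.
case: (prev) => p_lt _ _ _; case: (next) => r_gt _ Xr _.
have r_gt2 : level d <> level b -> q.+2 + L < r'.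
  move=> db; have r_ne : r' <> q.+2 + L; last lia.
  by move=> e; move: Xr; rewrite e X_period /at_level -/d; lia.
have in_prev j : level a = j -> 0 < cnt (lv j) p' (q.+1 + L).
  move=> aj; apply/cnt_gt0P; exists (q + L).
  by rewrite X_period /at_level -/a aj eqxx; split=> //; lia.
have in_next j : level d = j -> level d <> level b -> 0 < cnt (lv j) (q.+1 + L) r'.
  move=> dj /r_gt2 gt; apply/cnt_gt0P; exists (q.+2 + L).
  by rewrite X_period /at_level -/d dj eqxx; split=> //; lia.
have low_a := in_prev (level b).-1; have low_d := in_next (level b).-1.
have up_a := in_prev (level b).+1; have up_d := in_next (level b).+1.
move: adj_ab adj_bd => [ab|[ab|[_ [? _]]]] [bd|[bd|[? _]]]; try lia.
Qed.

End Zigzag.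

End ConstantCounts.

End CyclicWords.

(** * The zigzag word *)

Lemma modn_succ q d :
  q.+1 %% d.+1 = if (q %% d.+1).+1 == d.+1 then 0 else (q %% d.+1).+1.
Proof.
have r_lt := ltn_pmod q (ltn0Sn d); case: eqP => [e|ne].
  by rewrite {1}(divn_eq q d.+1) -addnS modnMDl e modnn.
by rewrite {1}(divn_eq q d.+1) -addnS modnMDl modn_small //; lia.
Qed.

Section ZigzagWord.
Variable n : nat.
Hypothesis n_ge2 : 1 < n.
Local Notation gen := (tildeB_gen n).
Local Notation N := n.*2.+1.
Local Notation zz := (@zigzag_word n).

Definition phase_level f := if f < 2 then 0 else if f <= n.+1 then f.-1 else N - f.

Lemma phase_levelP f :
  f < 2 /\ phase_level f = 0 \/
  (2 <= f <= n.+1 /\ phase_level f = f.-1 \/ n.+1 < f /\ phase_level f = N - f).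
Proof. by rewrite /phase_level; case: ifP => ?; [|case: ifP => ?]; lia. Qed.

Lemma zigzag_period_level b f : f < N ->
  level (nth Bu (zigzag_period n b) f) = phase_level f.
Proof.
move=> f_lt.
have lev : [seq level g | g <- zigzag_period n b] =
           [:: 0; 0] ++ iota 1 n.-1 ++ n :: rev (iota 1 n.-1).
  have lev_s : [seq level g | g <- [seq Bs i | i <- enum 'I_n.-1]] = iota 1 n.-1.
    by rewrite -map_comp -[1]addn0 iotaDl -val_enum_ord -map_comp.
  by rewrite /zigzag_period !map_cat /= map_rev lev_s; case: b.
have -> : level (nth Bu (zigzag_period n b) f) =
          nth 0 [seq level g | g <- zigzag_period n b] f.
  by rewrite (nth_map Bu) // size_zigzag_period //; lia.
rewrite lev /phase_level nth_cat /=.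
case: ltnP => f_ge; first by case: f f_lt f_ge => [|[]].
rewrite nth_cat size_iota; case: ltnP => f_ge2; case: leqP => f_le; try lia.
  by rewrite nth_iota //; lia.
- have -> : f - 2 - n.-1 = 0 by lia.
  by rewrite /=; lia.
have -> : f - 2 - n.-1 = (f - n.+2).+1 by lia.
by rewrite /= nth_rev size_iota ?nth_iota; lia.
Qed.

Lemma zigzag_level b q : level (zz b q) = phase_level (q %% N).
Proof. by rewrite /zigzag_word zigzag_period_level // ltn_mod. Qed.

Lemma zigzag_phase0 b q : q %% N = 0 -> zz b q = if b (q %/ N) then Bt2 else Bt1.
Proof. by rewrite /zigzag_word => ->; rewrite /zigzag_period; case: (b _). Qed.

Lemma zigzag_phase1 b q : q %% N = 1 -> zz b q = if b (q %/ N) then Bt1 else Bt2.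
Proof. by rewrite /zigzag_word => ->; rewrite /zigzag_period; case: (b _). Qed.

Lemma divn_succ q : (q %% N).+1 != N -> q.+1 %/ N = q %/ N.
Proof.
move=> r_ne; have r_lt : (q %% N).+1 < N by have := ltn_pmod q (ltn0Sn n.*2); lia.
by rewrite {1}(divn_eq q N) -addnS divnMDl // (divn_small r_lt) addn0.
Qed.

Lemma zigzag_t_neq b q : q %% N = 0 -> zz b q != zz b q.+1.
Proof.
move=> q0; have q1 : q.+1 %% N = 1 by rewrite modn_succ q0; case: eqP; lia.
rewrite zigzag_phase0 // zigzag_phase1 // divn_succ ?q0; last lia.
by case: (b _).
Qed.

Lemma zigzag_step_adjacent (a b c : gen) : zigzag_step a b c ->
  level a = 0 /\ level b = 0 \/ level b = (level a).+1 \/ level a = (level b).+1.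
Proof.
have b_le := level_le n_ge2 b.
by rewrite /zigzag_step; do 2?case: ifP; lia.
Qed.

(** Apart from the order of t_1 and t_2, a zigzag step only concerns levels. *)
Lemma zigzag_step_neq (a b c : gen) : zigzag_step a b c -> (a != b) && (b != c).
Proof.
rewrite /zigzag_step; case: (eqVneq a b) => [->|_]; case: (eqVneq b c) => [->|_] //=;
  by do 2?case: ifP; rewrite ?andbF //=; lia.
Qed.

Lemma zigzag_step_levels (a b c a' b' c' : gen) :
    level a' = level a -> level b' = level b -> level c' = level c ->
    (level a' = 0 -> level b' = 0 -> a' != b') ->
    (level b' = 0 -> level c' = 0 -> b' != c') ->
  zigzag_step a b c -> zigzag_step a' b' c'.
Proof.
rewrite /zigzag_step => -> -> -> ne1 ne2; case: eqP => // b0.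
case/orP=> /and3P[/eqP a0 x y]; apply/orP; [left | right]; apply/and3P; split=> //.
- exact/eqP.
- exact: ne1.
- exact/eqP.
- by apply: ne2 => //; apply/eqP.
Qed.

Lemma zigzag_step_zz b q : zigzag_step (zz b q) (zz b q.+1) (zz b q.+2).
Proof.
have := phase_levelP (q %% N); have := phase_levelP (q.+1 %% N).
have := phase_levelP (q.+2 %% N); rewrite -!(zigzag_level b).
have := @zigzag_t_neq b q; have := @zigzag_t_neq b q.+1.
have := modn_succ q.+1 n.*2; have := modn_succ q n.*2; have := ltn_pmod q (ltn0Sn n.*2).
rewrite /zigzag_step; move: (zz b q) (zz b q.+1) (zz b q.+2) => x y z.
move: (level x) (level y) (level z) (x != y) (y != z) => lx ly lz xy yz.
move: (q %% N) (q.+1 %% N) (q.+2 %% N) => r0 r1 r2 r0_lt.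
case: (eqVneq r0.+1 N) => e0 -> /=; case: eqP => e1 -> t1 t0; try lia.
all: do 3?case=> [[? ?]|[[? ?]|[? ?]]]; try lia.
all: by case: eqP => ?; try lia; case: eqP => ?; lia.
Qed.

Lemma zigzag_step_unique (a b c c' : gen) :
    zigzag_step a b c -> zigzag_step a b c' ->
  c = c' \/ [/\ level b = 1, level c = 0 & level c' = 0].
Proof.
move=> s s'; have [/andP[ab bc] /andP[_ bc']] := (zigzag_step_neq s, zigzag_step_neq s').
have [lc|lc] := eqVneq (level c) (level c'); last first.
  by exfalso; move: s s'; rewrite /zigzag_step; do 2?case: ifP; lia.
case: (posnP (level c)) => [c0|c_gt0]; last by left; apply: level_inj.
move: (c0) lc bc bc' => /(level0P n_ge2) c_t; rewrite c0 => /esym c0' bc bc'.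
case: (posnP (level b)) => [b0|b_gt0].
  left; case: (level0P n_ge2 b0) c_t (level0P n_ge2 c0') bc bc' => -> [] -> [] ->; by rewrite ?eqxx.
by right; split=> //; move: s; rewrite /zigzag_step c0; do 2?case: ifP; lia.
Qed.

Lemma zigzag_start (a b c : gen) : zigzag_step a b c ->
  exists e p, zz (fun=> e) p = a /\ zz (fun=> e) p.+1 = b.
Proof.
move=> s; have /andP[ab _] := zigzag_step_neq s.
have [a_le b_le] := (level_le n_ge2 a, level_le n_ge2 b).
have adj := zigzag_step_adjacent s.
have zz_eq e p g : 0 < level g -> p < N -> phase_level p = level g ->
    zz (fun=> e) p = g.
  move=> g_gt0 p_lt lev; have lev_g : level (zz (fun=> e) p) = level g.
    by rewrite zigzag_level modn_small.
  by apply: level_inj; rewrite ?lev_g.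
have [[a0 b0]|[b_up|a_up]] := adj.
- exists (a == Bt2), 0; rewrite zigzag_phase0 ?mod0n // zigzag_phase1; last first.
    by rewrite modn_small //; lia.
  by case: (level0P n_ge2 a0) (level0P n_ge2 b0) ab => -> [] ->; rewrite ?eqxx.
- case: (posnP (level a)) => [a0|a_gt0].
    exists (a == Bt1), 1; rewrite zigzag_phase1; last by rewrite modn_small //; lia.
    split; first by case: (level0P n_ge2 a0) => ->; rewrite ?eqxx.
    by apply: zz_eq; have := phase_levelP 2; lia.
  exists true, (level a).+1.
  by split; apply: zz_eq; have := phase_levelP (level a).+1;
    have := phase_levelP (level a).+2; lia.
- case: (posnP (level b)) => [b0|b_gt0].
    exists (b == Bt2), n.*2; split.
      by apply: zz_eq; have := phase_levelP n.*2; lia.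
    rewrite zigzag_phase0 ?modnn //.
    by case: (level0P n_ge2 b0) => ->; rewrite ?eqxx.
  exists true, (N - level a).
  by split; apply: zz_eq; have := phase_levelP (N - level a);
    have := phase_levelP (N - level a).+1; lia.
Qed.

(** Reading a word from left to right, each letter is forced by the two previous
    ones except for the first letter of a pair t_1 t_2, and there the bit of the
    new period can be chosen freely. *)
Lemma zigzag_subword_of_steps (x : seq gen) : 3 <= size x ->
    (forall q, q.+2 < size x ->
       zigzag_step (nth Bu x q) (nth Bu x q.+1) (nth Bu x q.+2)) ->
  zigzag_subword x.
Proof.
move=> x_ge3 steps; have [e [p [x0 x1]]] := zigzag_start (steps 0 x_ge3).
suff [b xb] : exists b, forall j, j < size x -> nth Bu x j = zz b (p + j).
  exists b, p; apply: (@eq_from_nth _ Bu); first by rewrite size_map size_iota.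
  by move=> j j_lt; rewrite xb // (nth_map 0) ?size_iota // nth_iota.
suff H k : k.+2 <= size x -> exists b, forall j, j < k.+2 -> nth Bu x j = zz b (p + j).
  by have [b xb] := H (size x).-2 ltac:(lia); exists b => j j_lt; apply: xb; lia.
elim: k => [|k IHk] k_le.
  by exists (fun=> e) => -[|[|j]] // _; rewrite ?addn0 ?addn1.
have {IHk}[b xb] := IHk (ltnW k_le).
have sx := steps k k_le; have sz := zigzag_step_zz b (p + k).
rewrite (xb k) // (xb k.+1) // !addnS in sx; have [xk|[l1 l0 l0']] := zigzag_step_unique sx sz.
  exists b => j; rewrite ltnS leq_eqVlt => /orP[/eqP->|]; last exact: xb.
  by rewrite xk !addnS.
set Q := p + k.+2; rewrite -[(p + k).+2]/((p + k).+1.+1) -!addnS -/Q in l0'.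
have Q0 : Q %% N = 0.
  move: l1 l0'; rewrite !zigzag_level /Q !addnS (modn_succ (p + k).+1).
  have := phase_levelP ((p + k).+1 %% N); have := ltn_pmod (p + k).+1 (ltn0Sn n.*2).
  move: ((p + k).+1 %% N) => r r_lt; case: eqP => // r_ne.
  by have := phase_levelP r.+1; lia.
exists (fun m => if m == Q %/ N then nth Bu x k.+2 == Bt2 else b m) => j.
rewrite ltnS leq_eqVlt => /orP[/eqP->|j_lt].
  by rewrite zigzag_phase0 // eqxx; case: (level0P n_ge2 l0) => ->; rewrite ?eqxx.
rewrite xb // /zigzag_word; case: eqP => // same; exfalso.
have := divn_eq Q N; rewrite Q0 -same; have := divn_eq (p + j) N.
have := ltn_pmod (p + j) (ltn0Sn n.*2); rewrite /Q; lia.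
Qed.

End ZigzagWord.

(** * Cyclic words *)

Section Alternate.
Variable T : eqType.
Implicit Types (a b c : T) (x : seq T).

Lemma alternateP a b x :
  reflect (forall u c v w, x = u ++ c :: v ++ c :: w -> (c == a) || (c == b) ->
             has (fun d => (d == a) || (d == b)) v)
          (alternate a b x).
Proof.
rewrite /alternate; set P := fun d => (d == a) || (d == b).
apply: (iffP idP) => [alt u c v w ex Pc|].
  apply/negPn/negP; rewrite -all_predC => /all_filterP v0.
  have fv0 : filter P v = [::].
    by rewrite -v0 -filter_predI; elim: (v) => //= d v' ->; rewrite andbN.
  move: alt; rewrite ex filter_cat /= -/(P c) /P Pc filter_cat -/P fv0 /= /P Pc.
  by move/cat_sorted2 => [_]; rewrite /= eqxx.
elim: x => [//|d x IHx] no_rep /=.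
have {}IHx : sorted (fun c d => c != d) (filter P x).
  by apply: IHx => u c v w ex; apply: (no_rep (d :: u)); rewrite ex.
rewrite -/(P d); case: ifP => // Pd /=.
have first : forall y, has P y -> exists v e w, [/\ y = v ++ e :: w, P e,
    ~~ has P v & filter P y = e :: filter P w].
  elim=> //= e y IHy; case: ifP => [Pe _|nPe /= /IHy[v [e' [w [-> Pe' nv ->]]]]].
    by exists [::], e, y.
  by exists (e :: v), e', w; rewrite /= nPe.
case: (boolP (has P x)) => [/first[v [e [w [ex Pe nv fx]]]]|].
  rewrite fx /= in IHx *; rewrite IHx andbT; apply/eqP => de; subst e.
  by have := no_rep [::] d v w; rewrite ex => /(_ erefl Pd); rewrite (negPf nv).
by rewrite has_filter negbK => /eqP->.
Qed.

End Alternate.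

Section CyclicSequence.
Variable n : nat.
Local Notation gen := (tildeB_gen n).
Implicit Types x y : seq gen.

Definition cyclic_seq x q := nth Bu x (q %% size x).

Lemma cyclic_seq_period x q : cyclic_seq x (q + size x) = cyclic_seq x q.
Proof. by rewrite /cyclic_seq modnDr. Qed.

Lemma cyclic_seq_small x q : q < size x -> cyclic_seq x q = nth Bu x q.
Proof. by move=> q_lt; rewrite /cyclic_seq modn_small. Qed.

Lemma window_cyclic_seq x : window (cyclic_seq x) 0 (size x) = x.
Proof.
apply: (@eq_from_nth _ Bu) => [|i]; rewrite size_window subn0 // => i_lt.
by rewrite (nth_map 0) ?size_iota ?subn0 // nth_iota ?subn0 // add0n cyclic_seq_small.
Qed.

Lemma cyclic_seq_rot1 g x q :
  cyclic_seq (rcons x g) q = cyclic_seq (g :: x) q.+1.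
Proof.
rewrite /cyclic_seq size_rcons [size (g :: x)]/= modn_succ nth_rcons.
have := ltn_pmod q (ltn0Sn (size x)); move: (q %% _) => r r_lt; rewrite eqSS.
by case: (ltngtP r (size x)) => //; lia.
Qed.

Lemma window_rot x p : 0 < size x ->
  window (cyclic_seq x) p (p + size x) = rot (p %% size x) x.
Proof.
move=> x_gt0; apply: (@eq_from_nth _ Bu).
  by rewrite size_window size_rot; lia.
rewrite size_window => i i_lt; have {}i_lt : i < size x by lia.
rewrite (nth_map 0) ?size_iota ?nth_iota; try lia.
rewrite /cyclic_seq -modnDml /rot nth_cat size_drop.
have r_lt : p %% size x < size x by rewrite ltn_mod.
move: (p %% size x) r_lt => r r_lt.
case: ltnP => i_r; first by rewrite nth_drop modn_small //; lia.
rewrite nth_take; last lia.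
have -> : r + i = (i - (size x - r)) + size x by lia.
by rewrite modnDr modn_small //; lia.
Qed.

End CyclicSequence.

(** * From cyclic full commutativity to the three families *)

Section Classification.
Variable n : nat.
Hypothesis n_ge2 : 1 < n.
Local Notation gen := (tildeB_gen n).
Local Notation mB := (tildeB_matrix n).
Implicit Types x y : seq gen.

Lemma alternate_cyclic_seq (S : eqType) (f : gen -> S) (a b : S) x
    (P := fun q => (f (cyclic_seq x q) == a) || (f (cyclic_seq x q) == b)) :
    (forall p q, p < q -> q < size x -> f (cyclic_seq x p) = f (cyclic_seq x q) ->
       P p -> exists2 r, p < r < q & P r) ->
  alternate a b [seq f g | g <- x].
Proof.
move=> between; apply/alternateP => u c v w ex Pc.
have sz : size x = size u + (size v + (size w).+1).+1.
  by rewrite -(size_map f) ex !size_cat /= size_cat.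
have X_nth q : q < size x -> f (cyclic_seq x q) = nth c (u ++ c :: v ++ c :: w) q.
  by move=> q_lt; rewrite cyclic_seq_small // -ex (nth_map Bu).
have Xp : f (cyclic_seq x (size u)) = c.
  by rewrite X_nth; [rewrite nth_cat ltnn subnn | lia].
have Xq : f (cyclic_seq x (size u + (size v).+1)) = c.
  rewrite X_nth; last lia.
  rewrite nth_cat ltnNge leq_addr addKn /= nth_cat ltnn subnn //.
have [||||r r_in] := between (size u) (size u + (size v).+1); rewrite ?Xp ?Xq //; try lia.
  by rewrite /P Xp.
rewrite /P X_nth; last lia.
rewrite nth_cat ltnNge (ltnW (proj1 (andP r_in))) /=.
have -> : r - size u = (r - (size u).+1).+1 by lia.
rewrite /= nth_cat; case: ltnP => [r_lt Pr|]; last lia.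
by apply/(has_nthP c); exists (r - (size u).+1).
Qed.

Lemma CFC_conditions x : (forall k, fc_word mB (rot k x)) ->
  CFC_cond_a x \/ CFC_cond_b x \/ CFC_cond_c x.
Proof.
case: (posnP (size x)) => [/size0nil-> _|L_gt0 x_fc]; first by left.
pose X := cyclic_seq x; pose L := size x.
have X_period q : X (q + L) = X q by apply: cyclic_seq_period.
have X_fc p : fc_word mB (window X p (p + L)) by rewrite window_rot.
have total_count a : cnt X a 0 L = count a x by rewrite /cnt window_cyclic_seq.
have [a_x|] := boolP [forall g : gen, count_mem g x <= 1].
  by left=> g; apply: (forallP a_x).
rewrite negb_forall => /existsP[g]; rewrite -ltnNge -total_count => cg; right.
have [] := total_constant n_ge2 L_gt0 X_period X_fc cg.
move c_def: (cnt X (at_level n.-1) 0 L) => c c_ge2 tot.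
have cnt_s (i : 'I_n.-1) : count_mem (Bs i) x = c.
  rewrite -total_count (total_letter n_ge2) // tot //=.
have cnt_t t : level t = 0 -> (count_mem t x).*2 = c.
  by move=> t0; rewrite -mul2n -total_count; apply: (total_tE n_ge2 L_gt0 X_period X_fc c_ge2 tot).
have [one|zt] := top_dichotomy n_ge2 L_gt0 X_period X_fc c_ge2 tot; [left | right].
  have one_lv := one_per_level n_ge2 L_gt0 X_period X_fc c_ge2 tot one.
  split; last first.
    exists c; split=> //; try exact: cnt_t.
    rewrite -total_count (total_letter n_ge2) /=; last lia.
    exact: (total_top n_ge2 L_gt0 X_period X_fc c_ge2 tot one).
  split=> [i i_lt|].
    apply: alternate_cyclic_seq => p q pq q_lt e_pq Pp.
    have [one1 one2] := one_lv i i_lt.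
    case/orP: Pp => lev.
      have [||q' [pq' q'_le]] := @next_arc _ X (at_level i) p q pq; rewrite /at_level -?e_pq //.
      have /cnt_gt0P[r [r_in Xr]] : 0 < cnt X (at_level i.+1) p q' by rewrite (one2 _ _ pq').
      exists r; last by rewrite /X /at_level in Xr; rewrite Xr orbT.
      have : r <> p by move=> e; move: Xr lev; rewrite e /at_level -/X; lia.
      lia.
    have [||q' [pq' q'_le]] := @next_arc _ X (at_level i.+1) p q pq; rewrite /at_level -?e_pq //.
    have /cnt_gt0P[r [r_in Xr]] : 0 < cnt X (at_level i) p q' by rewrite (one1 _ _ pq').
    exists r; last by rewrite /X /at_level in Xr; rewrite Xr.
    have : r <> p by move=> e; move: Xr lev; rewrite e /at_level -/X; lia.
    lia.
  rewrite -[x]map_id; apply: alternate_cyclic_seq => p q pq q_lt e_pq Pp.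
  have tb := t_between n_ge2 L_gt0 X_period X_fc c_ge2 tot one.
  have key t t' : level t = 0 -> (forall g0, level g0 = 0 -> g0 = t \/ g0 = t') -> t != t' ->
      X p = t -> exists2 r, p < r < q & X r = t'.
    move=> t0 tt' ne Xp; have [||q' [pq' q'_le]] := @next_arc _ X (pred1 t) p q pq.
    - by rewrite /= Xp.
    - by rewrite /= -Xp /X e_pq.
    have /cnt_gt0P[r [r_in /eqP Xr]] := tb t t' p q' t0 tt' pq'.
    exists r => //; have : r <> p by move=> e; move/eqP: ne; rewrite -Xr e Xp.
    lia.
  case/orP: Pp => /eqP Xp.
    have [|r r_in Xr] := key Bt1 Bt2 erefl _ isT Xp; first exact: level0P.
    by exists r => //; rewrite -/X Xr eqxx orbT.
  have [|r r_in Xr] := key Bt2 Bt1 erefl _ isT Xp.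
    by move=> h /(level0P n_ge2)[]; [right | left].
  by exists r => //; rewrite -/X Xr eqxx.
have c_u : (count_mem Bu x).*2 = c.
  rewrite -mul2n -total_count (total_letter n_ge2) /=; last lia.
  exact: (total_u n_ge2 L_gt0 X_period X_fc c_ge2 tot zt).
split; last by exists c; split=> //; apply: cnt_t.
apply: zigzag_subword_of_steps => // [|q q_lt].
  have := count_size (fun g => at_level 0 g || at_level 1 g) x.
  rewrite -total_count cnt_disjointU; last exact: lv_disjoint.
  by rewrite !tot; lia.
rewrite -!cyclic_seq_small; try lia.
exact: (zigzag_step_seq n_ge2 L_gt0 X_period X_fc c_ge2 tot zt).
Qed.

End Classification.

(** * The three families are cyclically fully commutative *)

Section Converse.
Variable n : nat.
Hypothesis n_ge2 : 1 < n.
Local Notation gen := (tildeB_gen n).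
Local Notation mB := (tildeB_matrix n).
Implicit Types (x y : seq gen) (i j g : gen).

Lemma tildeB_CFC_of_stable (C : seq gen -> Prop) x :
    (forall i j b, mB i j = 2 -> C ([:: i; j] ++ b) -> C ([:: j; i] ++ b)) ->
    (forall i b, C (i :: b) -> C (rcons b i)) ->
    (forall a b i, ~ C (a ++ [:: i; i] ++ b)) ->
    (forall a b i j, 2 < mB i j -> ~ C (a ++ altw i j (mB i j) ++ b)) ->
  C x -> CFC (eval_word mB x).
Proof.
apply: CFC_of_stable; last exact: tildeB_order.
move=> i j; have [<-|/tildeB_m_neq] := eqVneq i j; last by case=> [->|[->|->]].
by have /eqP-> : mB i i == 1 by rewrite cox_m_diag.
Qed.

Lemma CFC_cond_a_CFC x : CFC_cond_a x -> CFC (eval_word mB x).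
Proof.
apply: tildeB_CFC_of_stable.
- by move=> i j b _ Ca g; have := Ca g; rewrite /= addnCA.
- by move=> i b Ca g; have := Ca g; rewrite -cats1 count_cat /= addn0 addnC.
- by move=> a b i /(_ i); rewrite !count_cat /= eqxx; lia.
move=> a b i j m_ij /(_ i); rewrite !count_cat.
by case: (mB i j) m_ij => [|[|[|k]]] //= _; rewrite eqxx; lia.
Qed.

(** ** Alternating words *)

Lemma commuting_levels i j : mB i j = 2 ->
  ~~ adjacent_levels i j /\ (level i = level j -> level i = 0 /\ level j = 0).
Proof.
move=> m_ij; have ne : i != j by rewrite -(cox_m_diag mB) m_ij.
split; first by rewrite -tildeB_m_neq2 // m_ij.
move=> e; case: (posnP (level i)) => [i0|i_gt0]; first by rewrite -e.
by move: ne; rewrite (level_inj n_ge2 i_gt0 e) eqxx.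
Qed.

Lemma alternate_rot1 (T : eqType) (a b c : T) (x : seq T) : a != b ->
    count_mem a (c :: x) = count_mem b (c :: x) ->
  alternate a b (c :: x) -> alternate a b (rcons x c).
Proof.
move=> ne_ab; rewrite /alternate; set P := fun d => (d == a) || (d == b).
have filter_count s : count_mem a s + count_mem b s = size (filter P s).
  elim: s => //= d s IHs; rewrite addnACA IHs /P.
  by case: eqP => [->|_]; rewrite ?(negPf ne_ab) //=; case: eqP.
move=> cnt_eq; have := filter_count (c :: x); rewrite cnt_eq filter_rcons /= -/(P c).
case: ifP => // Pc size_f alt.
(* In an alternating sequence the last letter differs from the first one
   exactly when the length is even. *)
have last_par f d : P d -> all P f -> path (fun c d => c != d) d f ->
    (last d f == d) = ~~ odd (size f).
  elim: f d => [|e f IHf] d Pd /=; first by rewrite eqxx.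
  case/andP=> Pe Pf /andP[de ef]; rewrite -(IHf e) //.
  have Pl : P (last e f).
    have /allP Pall : all P (e :: f) by rewrite /= Pe.
    exact: Pall (mem_last e f).
  move: Pd Pe Pl de ne_ab; rewrite /P.
  by do 3!case/orP=> /eqP->; rewrite ?eqxx //= => de ab;
    rewrite ?(negPf de) ?(negPf ab) // eq_sym ?(negPf de) ?(negPf ab).
have f_all : all P (filter P x) by apply: filter_all.
have := last_par _ _ Pc f_all alt.
have -> : odd (size (filter P x)).
  by have := congr1 odd size_f; rewrite addnn odd_double => /esym/negbFE.
case: (filter P x) alt => [//|d f] /= /andP[_ df] last_c.
by rewrite rcons_path df last_c.
Qed.

(** In an alternating word with equal counts, any two cyclically consecutive
    occurrences of a letter are separated by letters of both adjacent levels, or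
    by the other t for the letters t_1 and t_2; this leaves no room for squares
    and braids. *)
Lemma CFC_cond_b_CFC x : CFC_cond_b x -> CFC (eval_word mB x).
Proof.
have no_rep y k l u i v w : CFC_cond_b y -> k < n ->
    level i = k /\ l = k.+1 \/ level i = k.+1 /\ l = k ->
    y = u ++ i :: v ++ i :: w -> ~~ has (fun g => level g == level i) v ->
    ~~ has (fun g => level g == l) v -> False.
  move=> [[alt _] _] k_lt il ey ni nl.
  pose lev := map (@level n).
  have /alternateP/(_ (lev u) (level i) (lev v) (lev w)) := alt k k_lt.
  rewrite ey !map_cat /= map_cat => /(_ erefl).
  have -> : (level i == k) || (level i == k.+1) by lia.
  move=> /(_ isT) /hasP[d /mapP[g gv ->]] Pg.
  move/hasPn: ni => /(_ g gv); move/hasPn: nl => /(_ g gv).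
  lia.
apply: tildeB_CFC_of_stable.
- move=> i j b m_ij [[alt altt] [c [c_ge2 cs cu ct1 ct2]]].
  have [nadj eq0] := commuting_levels m_ij.
  split; last first.
    exists c; split=> //.
    + by move=> k; rewrite -(cs k) /= addnCA.
    + by rewrite -cu /= addnCA.
    + by rewrite -ct1 /= addnCA.
    + by rewrite -ct2 /= addnCA.
  split=> [k k_lt|].
    have [lev|lev] := eqVneq (level i) (level j).
      by rewrite /= -lev; have := alt k k_lt; rewrite /= lev.
    have := alt k k_lt; rewrite /alternate /=.
    case: ifP => Pi; case: ifP => Pj //; exfalso.
    by move: nadj lev Pi Pj; rewrite /adjacent_levels; lia.
  have [/eq0[i0 j0]|lev] := eqVneq (level i) (level j).
    by have := alt 0 (ltnW n_ge2); rewrite /alternate /= i0 j0.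
  move: altt; rewrite /alternate /=; case: ifP => Pi; case: ifP => Pj //.
  exfalso; move/eqP: lev; apply.
  by case/orP: Pi => /eqP->; case/orP: Pj => /eqP->.
- move=> i b [[alt altt] [c [c_ge2 cs cu ct1 ct2]]].
  have cnt_rcons g : count_mem g (rcons b i) = count_mem g (i :: b).
    by rewrite -cats1 count_cat /= addn0 addnC.
  split; last first.
    by exists c; split=> // [k|||]; rewrite cnt_rcons.
  have cl k : k <= n -> count_mem k [seq level g | g <- i :: b] = c.
    move=> k_le; rewrite count_map; case: (posnP k) => [->|k_gt0].
      have -> : count (preim (@level n) (pred1 0)) (i :: b) =
                count_mem Bt1 (i :: b) + count_mem Bt2 (i :: b).
        exact: count_level0.
      lia.
    have [g lev_g] := level_exists n_ge2 k_le.
    have -> : count (preim (@level n) (pred1 k)) (i :: b) = count_mem g (i :: b).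
      apply: eq_count => h /=; apply/eqP/eqP => [e|-> //].
      by apply: level_inj; rewrite ?e ?lev_g.
    by case: g lev_g => [||k'|] /= lev_g; [lia | lia | exact: cs | exact: cu].
  split=> [k k_lt|].
    rewrite map_rcons; apply: alternate_rot1; [by rewrite neq_ltn ltnSn | | exact: alt].
    by have := cl k (ltnW k_lt); have := cl k.+1 k_lt; rewrite /= => -> ->.
  by apply: alternate_rot1 altt => //; apply: double_inj; rewrite ct1 ct2.
- move=> a b i Cb.
  have i_le := level_le n_ge2 i; have [i_lt|i_ge] := ltnP (level i) n.
    by apply: (@no_rep _ (level i) (level i).+1 a i [::] b Cb) => //; left.
  by apply: (@no_rep _ n.-1 n.-1 a i [::] b Cb) => //; lia.
move=> a b i j m_ij Cb.
have ne : i != j by apply/eqP => e; move: m_ij; rewrite e (eqP (_ : mB j j == 1)) ?cox_m_diag.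
have adj : adjacent_levels i j by rewrite -tildeB_m_neq2 //; lia.
have [i_le j_le] := (level_le n_ge2 i, level_le n_ge2 j).
(* Below level n, either s has neighbours at a level other than that of t, or s is
   one of t_1 and t_2; in both cases t alone does not separate the two s. *)
have inner y u w s t : CFC_cond_b y -> y = u ++ [:: s; t; s] ++ w ->
    adjacent_levels s t -> level s < n -> False.
  move=> Cy ey st s_lt; have ts : ~~ has (fun g => level g == level s) [:: t].
    by move: st; rewrite /adjacent_levels /=; lia.
  case: (posnP (level s)) => [s0|s_gt0].
    case: Cy => -[_ /alternateP/(_ u s [:: t] w ey)] + _.
    by case: (level0P n_ge2 s0) => es; rewrite es eqxx ?orbT => /(_ isT) /=;
      move: st; rewrite /adjacent_levels es; case: (t).
  have [t_lt|t_ge] := ltnP (level t) (level s).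
    apply: (@no_rep y (level s) (level s).+1 u s [:: t] w Cy) => //=; first by left.
    by lia.
  by apply: (@no_rep y (level s).-1 (level s).-1 u s [:: t] w Cy) => //=; lia.
have [i_lt|i_ge] := ltnP (level i) n.
  case E: (mB i j) m_ij Cb => [|[|[|k]]] // _ Cb.
  exact: (inner _ a (altw j i k ++ b) i j Cb erefl adj i_lt).
have jn : level j = n.-1 by move: adj; rewrite /adjacent_levels; lia.
have m4 : mB i j = 4 by rewrite cox_m_sym; apply: tildeB_m_top => //; lia.
rewrite m4 in Cb; apply: (inner _ (a ++ [:: i]) b j i Cb).
- by rewrite /= -catA.
- by rewrite /adjacent_levels orbC.
- by lia.
Qed.

(** ** Zigzag words *)

Local Notation N := n.*2.+1.

(** A local form of the third condition, invariant under cyclic shifts. *)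
Definition cyclic_zigzag x := 3 <= size x /\ forall q,
  zigzag_step (cyclic_seq x q) (cyclic_seq x q.+1) (cyclic_seq x q.+2).

(** Each period contains each of t_1 and t_2 once. *)
Lemma zigzag_cnt_t b t q k : level t = 0 -> q %% N = 0 ->
  cnt (@zigzag_word n b) (pred1 t) q (q + k * N) = k.
Proof.
move=> t0 q0; elim: k => [|k IHk]; first by rewrite addn0 cnt_nil.
rewrite (@cnt_cat _ _ (q + k * N)); last lia.
rewrite IHk -[RHS]addn1; congr (_ + _); set q' := q + k * N.
have -> : q + k.+1 * N = q' + N by rewrite /q'; lia.
have q'0 : q' %% N = 0 by rewrite /q' addnC modnMDl.
rewrite cntSl ?(@cntSl _ _ _ q'.+1); try lia.
have -> : cnt (@zigzag_word n b) (pred1 t) q'.+2 (q' + N) = 0.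
  apply: eq_cnt0 => r r_in; apply/eqP => e; have := congr1 (@level n) e.
  rewrite zigzag_level // t0.
  have -> : r = (q' %/ N) * N + (r - q') by have := divn_eq q' N; rewrite q'0; lia.
  rewrite modnMDl modn_small; last lia.
  by have := phase_levelP n_ge2 (r - q'); lia.
have := zigzag_t_neq n_ge2 b q'0.
have l0 : level (zigzag_word n b q') = 0 by rewrite zigzag_level // q'0.
have l1 : level (zigzag_word n b q'.+1) = 0.
  by rewrite zigzag_level // modn_succ q'0; case: eqP => //; lia.
by case: (level0P n_ge2 l0) => ->; case: (level0P n_ge2 l1) => ->;
  case: (level0P n_ge2 t0) => ->; rewrite /= ?eqxx.
Qed.

(** The counts make the length a multiple of the period, so the levels of the
    zigzag word continue across the end of x.  What remains is that a pair t_1 t_2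
    cut by the end of x consists of two different letters. *)
Lemma CFC_cond_c_cyclic x : CFC_cond_c x -> cyclic_zigzag x.
Proof.
case=> [[b [p ex]] [c [c_ge2 cs ct1 ct2 cu]]]; set L := size x in ex *.
have {}ex : x = window (@zigzag_word n b) p (p + L) by rewrite ex /window addKn.
have cl k : k < n -> count (at_level k) x = c.
  case: k => [|k] k_lt; first by rewrite count_level0 //; lia.
  have k_lt' : k < n.-1 by lia.
  rewrite -(cs (Ordinal k_lt')); apply: eq_count => g /=; rewrite /at_level.
  by apply/eqP/eqP => [e|-> //]; apply: level_inj; rewrite ?e.
have c_lt k : k <= n -> count (fun g : gen => level g < k) x = k * c.
  elim: k => [|k IHk] k_le; first by rewrite mul0n; elim: (x).
  rewrite mulSn addnC -IHk ?(ltnW k_le) // -[in RHS](cl k) // -count_predUI addnC.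
  have -> : count (predI (fun g : gen => level g < k) (at_level k)) x = 0.
    by apply/eqP; rewrite -leqn0 -(count_pred0 x); apply: sub_count => g /=; rewrite /at_level; lia.
  by apply: eq_count => g /=; rewrite /at_level ltnS leq_eqVlt orbC.
have L_eq : L = count_mem Bu x * N.
  have := count_predC (fun g : gen => level g < n) x; rewrite c_lt // -/L => <-.
  have -> : count (predC (fun g : gen => level g < n)) x = count_mem Bu x.
    apply: eq_count => g /=; rewrite -leqNgt -level_eqn // eqn_leq.
    by have := level_le n_ge2 g; lia.
  by rewrite -cu; lia.
have u_gt0 : 0 < count_mem Bu x by lia.
have L_gt0 : 0 < L by rewrite L_eq; lia.
have X_zz q : cyclic_seq x q = zigzag_word n b (p + q %% L).
  have r_lt : q %% L < L by rewrite ltn_mod.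
  by rewrite /cyclic_seq -/L {1}ex (nth_map 0) ?size_iota ?addKn // nth_iota ?addKn.
have X_lev q : level (cyclic_seq x q) = level (zigzag_word n b (p + q)).
  rewrite X_zz !zigzag_level // {2}(divn_eq q L) addnCA L_eq mulnA.
  by rewrite modnMDl.
split; first by rewrite -/L L_eq; lia.
have X_neq q : level (cyclic_seq x q) = 0 -> level (cyclic_seq x q.+1) = 0 ->
    cyclic_seq x q != cyclic_seq x q.+1.
  rewrite !X_zz; have := modn_succ q L.-1; rewrite prednK // => ->.
  have := ltn_pmod q L_gt0; move: (q %% L) => r r_lt.
  case: eqP => [rL|r_ne] l0 l1; last first.
    by rewrite addnS; have /andP[] := zigzag_step_neq n_ge2 (zigzag_step_zz n_ge2 b (p + r)).
  (* The word starts with the second letter of a pair t_1 t_2 and ends with the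
     first one; the counts of t_1 in the word and in its shift by one letter to
     the left agree. *)
  rewrite addn0 in l1 *; have rL' : r = L.-1 by lia.
  have p_phase : p %% N = if ((p + r) %% N).+1 == N then 0 else ((p + r) %% N).+1.
    rewrite -modn_succ -addnS rL' prednK // L_eq.
    by rewrite addnC modnMDl.
  have [r0 p1] : (p + r) %% N = 0 /\ p %% N = 1.
    move: l0 l1; rewrite !zigzag_level // p_phase.
    have := phase_levelP n_ge2 ((p + r) %% N); have := phase_levelP n_ge2 ((p + r) %% N).+1.
    by have := ltn_pmod (p + r) (ltn0Sn n.*2); case: eqP => ? ; lia.
  case: p => [|p'] in ex X_zz X_lev l0 l1 p_phase r0 p1 *; first by rewrite mod0n in p1.
  have p'0 : p' %% N = 0 by move: p1; rewrite modn_succ; case: eqP => // _ [].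
  have c_t : cnt (@zigzag_word n b) (pred1 Bt1) p' (p' + L) = count_mem Bu x.
    by rewrite L_eq zigzag_cnt_t.
  have c_t' : cnt (@zigzag_word n b) (pred1 Bt1) p'.+1 (p'.+1 + L) = count_mem Bu x.
    by rewrite /cnt -ex; apply: double_inj; rewrite ct1 cu.
  rewrite cntSl in c_t; last lia.
  rewrite addSn cntS in c_t'; last lia.
  have -> : p'.+1 + r = p' + L by lia.
  have same : (zigzag_word n b p' == Bt1) = (zigzag_word n b (p' + L) == Bt1).
    by move: c_t c_t' => /=; case: eqP; case: eqP => //; lia.
  have l2 : level (zigzag_word n b p') = 0 by rewrite zigzag_level // p'0.
  have l3 : level (zigzag_word n b (p' + L)) = 0.
    by rewrite zigzag_level //; have -> : p' + L = p'.+1 + r by [lia]; rewrite r0.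
  have -> : zigzag_word n b (p' + L) = zigzag_word n b p'.
    by move: same; case: (level0P n_ge2 l2) => ->; case: (level0P n_ge2 l3) => ->.
  exact: (zigzag_t_neq n_ge2 b p'0).
move=> q; have X_lev1 := X_lev q.+1; have X_lev2 := X_lev q.+2; rewrite !addnS in X_lev1 X_lev2.
apply: (zigzag_step_levels (X_lev q) X_lev1 X_lev2); [exact: X_neq | exact: X_neq |].
exact: zigzag_step_zz.
Qed.

(** Consecutive letters of a cyclic zigzag word commute only if they are t_1 and
    t_2, and exchanging these keeps all levels. *)
Lemma cyclic_zigzag_swap i j b : mB i j = 2 ->
  cyclic_zigzag ([:: i; j] ++ b) -> cyclic_zigzag ([:: j; i] ++ b).
Proof.
move=> m_ij [sz steps]; have [nadj _] := commuting_levels m_ij.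
set x := [:: i; j] ++ b in sz steps *; set y := [:: j; i] ++ b; set L := size x in sz.
have s0 : zigzag_step i j (nth Bu x 2) by have := steps 0; rewrite !cyclic_seq_small.
have [i0 j0] : level i = 0 /\ level j = 0.
  by have := zigzag_step_adjacent n_ge2 s0; move: nadj; rewrite /adjacent_levels; lia.
have s1 : zigzag_step (nth Bu x L.-1) i j.
  have e0 : cyclic_seq x L = i by rewrite /cyclic_seq -/L modnn.
  have e1 : cyclic_seq x L.+1 = j.
    by rewrite -[L.+1]/(1 + L) cyclic_seq_period cyclic_seq_small.
  have := steps L.-1; have -> : L.-1.+2 = L.+1 by rewrite prednK //; lia.
  rewrite prednK ?e0 ?e1; last lia.
  by rewrite cyclic_seq_small // -/L; lia.
have l2 : level (nth Bu x 2) = 1 by move: s0; rewrite /zigzag_step i0 j0 /=; lia.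
have lL : level (nth Bu x L.-1) = 1 by move: s1; rewrite /zigzag_step i0 j0 /=; lia.
have yE q : cyclic_seq y q =
    if q %% L == 0 then j else if q %% L == 1 then i else cyclic_seq x q.
  by rewrite /cyclic_seq -/L; have -> : size y = L by []; case: (q %% L) => [|[|r]].
have y_lev q : level (cyclic_seq y q) = level (cyclic_seq x q).
  rewrite yE; case: eqP => [q0|_]; first by rewrite /cyclic_seq -/L q0 /= i0.
  by case: eqP => [q1|//]; rewrite /cyclic_seq -/L q1 /= j0.
have y_neq q : level (cyclic_seq y q) = 0 -> level (cyclic_seq y q.+1) = 0 ->
    cyclic_seq y q != cyclic_seq y q.+1.
  move=> lq lq1; have r_lt : q %% L < L by rewrite ltn_mod; lia.
  have qS : q.+1 %% L = if (q %% L).+1 == L then 0 else (q %% L).+1.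
    by have := modn_succ q L.-1; rewrite prednK //; lia.
  have [q0|q_ne0] := eqVneq (q %% L) 0.
    have L1 : (1 == L) = false by lia.
    by rewrite !yE qS q0 L1 /= -(cox_m_diag mB) cox_m_sym m_ij.
  have [q1|q_ne1] := eqVneq (q %% L) 1.
    have L2 : (2 == L) = false by lia.
    by move: lq1; rewrite y_lev /cyclic_seq -/L qS q1 L2 l2.
  have [qL|q_neL] := eqVneq (q %% L).+1 L.
    move: lq; rewrite y_lev /cyclic_seq -/L; have -> : q %% L = L.-1 by lia.
    by rewrite lL.
  rewrite !yE qS (negPf q_ne0) (negPf q_ne1) (negPf q_neL) /= eqSS (negPf q_ne0).
  by have /andP[] := zigzag_step_neq n_ge2 (steps q).
by split=> // q; apply: zigzag_step_levels (steps q) => //; apply: y_neq.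
Qed.

Lemma CFC_cond_c_CFC x : CFC_cond_c x -> CFC (eval_word mB x).
Proof.
move/CFC_cond_c_cyclic; apply: tildeB_CFC_of_stable.
- exact: cyclic_zigzag_swap.
- move=> i b [sz steps]; split; first by rewrite size_rcons.
  by move=> q; rewrite !cyclic_seq_rot1.
- move=> a b i [_ /(_ (size a))/(zigzag_step_neq n_ge2)/andP[+ _]].
  rewrite !cyclic_seq_small ?size_cat /=; try lia.
  by rewrite !nth_cat ltnn subnn ltnNge leqnSn /= subSnn /= eqxx.
move=> a b i j m_ij [sz steps].
have turn y u w s t : (forall q, zigzag_step (cyclic_seq y q) (cyclic_seq y q.+1)
    (cyclic_seq y q.+2)) -> y = u ++ [:: s; t; s] ++ w -> level s = n.-1 /\ level t = n.
  move=> st ey; have := st (size u); rewrite !cyclic_seq_small ey ?size_cat /=; try lia.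
  rewrite !nth_cat ltnn subnn ltnNge leqnSn subSnn ltnNge.
  rewrite (leq_trans (leqnSn _) (leqnSn _)) /=.
  have -> : (size u).+2 - size u = 2 by lia.
  by rewrite /zigzag_step /=; do 2?case: ifP; lia.
have [li lj] : level i = n.-1 /\ level j = n.
  case E: (mB i j) m_ij steps => [|[|[|k]]] // _ steps.
  exact: (turn _ a (altw j i k ++ b) i j steps erefl).
have [lj' _] : level j = n.-1 /\ level i = n.
  apply: (turn _ (a ++ [:: i]) b j i steps).
  by rewrite (tildeB_m_top n_ge2 li lj) /= -catA.
by lia.
Qed.

End Converse.

(** * The classification *)

Theorem theorem3p4 (n : nat) (n_ge2 : 2 <= n) (w : tildeB n) :
  (CFC w <->
   exists x : seq (tildeB_gen n), reduced_expr w x /\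
     (CFC_cond_a x \/ CFC_cond_b x \/ CFC_cond_c x)) /\
  (CFC w <->
   forall x : seq (tildeB_gen n), reduced_expr w x ->
     (CFC_cond_a x \/ CFC_cond_b x \/ CFC_cond_c x)).
Proof.
have to_cond x : reduced_expr w x -> CFC w ->
    CFC_cond_a x \/ CFC_cond_b x \/ CFC_cond_c x.
  move=> xw w_CFC; apply: CFC_conditions => // k.
  by have [rot_red rot_FC] := w_CFC x xw k; apply: reduced_FC_fc_word.
have of_cond x : reduced_expr w x ->
    CFC_cond_a x \/ CFC_cond_b x \/ CFC_cond_c x -> CFC w.
  by case=> <- _ [Ca|[Cb|Cc]];
    [apply: CFC_cond_a_CFC | apply: CFC_cond_b_CFC | apply: CFC_cond_c_CFC].
have [x xw] := reduced_word_exists w.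
split; split=> [w_CFC|].
- by exists x; split=> //; apply: to_cond.
- by case=> y [yw]; apply: of_cond yw.
- by move=> y yw; apply: to_cond.
- by move=> conds; apply: of_cond xw (conds x xw).
Qed.
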